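(* Let $X$ be a real or complex Banach space and let $(T_t)_{t\ge 0}$ be a bounded $C_0$-semigroup of linear operators on $X$, i.e. a strongly continuous one-parameter semigroup with $\sup_{t\ge 0}\|T_t\|<\infty$. Suppose that there exists a compact set $K\subseteq X$ such that $$\liminf_{t\to\infty}\rho(T_t x,K)=0\quad\text{for every } x\in X\text{ with }\|x\|\le 1 .$$ Then the semigroup $(T_t)_{t\ge0}$ is asymptotically finite-dimensional: there exists a subspace $L\subseteq X$ with $\dim L<\infty$, invariant under all $T_t$, such that $$\lim_{t\to\infty}\rho(T_t x,L)=0\quad\text{for every } x\in X,$$ and there exists a closed subspace $X_0\subseteq X$, invariant under all $T_t$, such that $X=X_0\oplus L$ and $T_t x_0\to 0$ as $t\to\infty$ for every $x_0\in X_0$.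
   Context: For $x\in X$ and $Y\subseteq X$, $\rho(x,Y)=\inf_{y\in Y}\|x-y\|$ denotes the distance from $x$ to $Y$. *)

(* Defs.v *)
From HB Require Import structures.
From mathcomp Require Import all_boot all_order all_algebra.
From mathcomp Require Import all_classical all_reals all_analysis.
From mathcomp Require Import complex.

Set Implicit Arguments.
Unset Strict Implicit.
Unset Printing Implicit Defensive.

Import Order.TTheory GRing.Theory Num.Theory.
Import numFieldNormedType.Exports.

Local Open Scope classical_set_scope.
Local Open Scope ring_scope.

Variant scalar_kind := RealScalars | ComplexScalars.

Definition scalar_field (R : realType) (k : scalar_kind) : numFieldType :=
  match k with RealScalars => R | ComplexScalars => R[i] end.

Definition scalar_re (R : realType) (k : scalar_kind) : scalar_field R k -> R :=
  match k with RealScalars => id | ComplexScalars => @complex.Re R end.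

Section BanachSpaceNotions.
Variables (R : realType) (k : scalar_kind).
Local Notation K := (scalar_field R k).
Variable X : completeNormedModType K.

(* The library norm of X takes its values in K, where they are nonnegative,
   hence real; this is the same number seen in R. *)
Definition real_norm (x : X) : R := scalar_re `|x|.

(* Extended-real valued, with value +oo (not 0) on the empty set. *)
Definition rho (x : X) (Y : set X) : \bar R :=
  ereal_inf [set (real_norm (x - y))%:E | y in Y].

Definition op_norm (f : X -> X) : \bar R :=
  ereal_sup [set (real_norm (f x))%:E | x in [set x | real_norm x <= 1]].

(* Only the values T t with 0 <= t are constrained. *)
Definition C0_semigroup (T : R -> {linear X -> X}) : Prop :=
  [/\ forall t, 0 <= t -> continuous (T t),
      forall x, T 0 x = x,
      forall s t, 0 <= s -> 0 <= t -> forall x, T (s + t) x = T s (T t x) &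
      forall x, T t x @[t --> 0^'+] --> x].

Definition bounded_semigroup (T : R -> {linear X -> X}) : Prop :=
  (ereal_sup [set op_norm (T t) | t in [set t : R | 0 <= t]%R] < +oo)%E.

Definition linear_subspace (L : set X) : Prop := submod_closed (mem L).

Definition finite_dim (L : set X) : Prop :=
  exists (n : nat) (e : 'I_n -> X),
    (forall c : 'I_n -> K, \sum_i c i *: e i = 0 -> forall i, c i = 0) /\
    L = [set \sum_i c i *: e i | c in [set: 'I_n -> K]].

Definition invariant_under (T : R -> {linear X -> X}) (L : set X) : Prop :=
  forall t, 0 <= t -> T t @` L `<=` L.

Definition direct_sum (A B : set X) : Prop :=
  [set a + b | a in A & b in B] = [set: X] /\ A `&` B = [set 0].

End BanachSpaceNotions.

(* Main.v *)
Require Import Defs.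
From HB Require Import structures.
From mathcomp Require Import all_boot all_order all_algebra.
From mathcomp Require Import all_classical all_reals all_analysis.
From mathcomp Require Import cyclic separable cyclotomic.
From mathcomp Require Import complex ring lra zify.
Import Order.TTheory GRing.Theory Num.Theory.
Import numFieldNormedType.Exports.
Local Open Scope classical_set_scope.
Local Open Scope ring_scope.

Set Implicit Arguments.
Unset Strict Implicit.
Unset Printing Implicit Defensive.

(** The seminorm [q x = limsup_t |T_t x|] vanishes exactly on the vectors with
    [T_t x -> 0], and every [T_t] is isometric for it. The hypothesis makes every
    orbit starting in the open [q]-unit ball come close to [K] at arbitrarily late
    times; since [K] is compact, two late visits near the same point show that every
    vector is [q]-recurrent. Hence closed invariant subspaces are invariant
    backwards in time, and dividing by one of them (that is, replacing [q] by the
    [q]-distance to it) preserves the whole situation.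

    Modulo [ker q] there is a nonzero finite-dimensional invariant subspace: for an isometry
    [u], averaging the squares of the sums [sum_(j < n) l^(n-1-j) u^j] over the roots
    of unity [l] of order [2n] shows that [u^2 - 2 c u + 1] is not bounded below for
    some [c] in [-1, 1]. Moving approximate kernel vectors into [K], where they
    accumulate, gives exact kernel vectors, first for [u = T_1], then inside this
    kernel for [T_(1/2)], [T_(1/4)], and so on. On the intersection of these kernels
    [T_(2^-(j+1)) = (T_(2^-j) + 1) / (2 c_(j+1))] for large [j], so the span of [x]
    and [T_(2^-j) x] is invariant.

    Iterating this modulo the subspaces already found must stop, since otherwise
    hitting times produce infinitely many points of [K] at mutual [q]-distance
    bounded below. So [X / ker q] is finite-dimensional.

    Finally, if [y] is an omega-limit point of [x], then
    [|T_a y - T_b y| <= q (T_a x - T_b x)]; so orbits are relatively compact and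
    [P x = lim T_t x] exists along an ultrafilter at infinity. The range of [P] is
    the required [L], and [ker q] is [X_0]. *)

(** * Seminorms, subspaces and finite spans *)

Section Subspaces.
Variables (F : pzRingType) (V : lmodType F).
Implicit Types L : set V.

Definition subspace L := L 0 /\ forall a x y, L x -> L y -> L (a *: x + y).

Section SubspaceTheory.
Variables (L : set V) (hL : subspace L).
Lemma subspace0 : L 0. Proof. exact: hL.1. Qed.
Lemma subspaceP a x y : L x -> L y -> L (a *: x + y). Proof. exact: hL.2. Qed.
Lemma subspaceD x y : L x -> L y -> L (x + y).
Proof. by move=> Lx; rewrite -[x]scale1r; exact: subspaceP. Qed.
Lemma subspaceZ a x : L x -> L (a *: x).
Proof. by move=> Lx; rewrite -[_ *: x]addr0; apply: subspaceP Lx subspace0. Qed.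
Lemma subspaceN x : L x -> L (- x).
Proof. by move=> Lx; rewrite -scaleN1r; exact: subspaceZ. Qed.
Lemma subspaceB x y : L x -> L y -> L (x - y).
Proof. by move=> Lx Ly; apply: subspaceD => //; exact: subspaceN. Qed.
End SubspaceTheory.

End Subspaces.

Section Seminorms.
Variables (R : realType) (V : lmodType R).
Implicit Types (q : V -> R) (L : set V).

Definition seminorm q :=
  (forall x y, q (x + y) <= q x + q y) /\ (forall a x, q (a *: x) = `|a| * q x).

(** Applying the inequality to the inverse scalar gives its converse; [q 0 = 0] settles the scalar
    0. *)
Lemma seminorm_intro q : (forall x y, q (x + y) <= q x + q y) ->
  q 0 = 0 -> (forall a x, q (a *: x) <= `|a| * q x) -> seminorm q.
Proof.
move=> hD h0 hZ; split => // a x; apply/eqP; rewrite eq_le hZ /=.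
have [->|a0] := eqVneq a 0; first by rewrite normr0 mul0r scale0r h0.
have := hZ a^-1 (a *: x); rewrite scalerA mulVf // scale1r normfV.
by rewrite -ler_pdivlMl ?invr_gt0 ?normr_gt0// invrK.
Qed.

Section SeminormTheory.
Variables (q : V -> R) (hq : seminorm q).

Lemma seminormD x y : q (x + y) <= q x + q y. Proof. exact: hq.1. Qed.
Lemma seminormZ a x : q (a *: x) = `|a| * q x. Proof. exact: hq.2. Qed.
Lemma seminorm0 : q 0 = 0.
Proof. by rewrite -(scale0r (0 : V)) seminormZ normr0 mul0r. Qed.
Lemma seminormN x : q (- x) = q x.
Proof. by rewrite -scaleN1r seminormZ normrN1 mul1r. Qed.
Lemma seminormC x y : q (x - y) = q (y - x).
Proof. by rewrite -seminormN opprB. Qed.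
Lemma seminorm_ge0 x : 0 <= q x.
Proof.
by have := seminormD x (- x); rewrite subrr seminorm0 seminormN -mulr2n pmulrn_lge0.
Qed.
Lemma seminorm_trans x y z : q (x - z) <= q (x - y) + q (y - z).
Proof. by rewrite -[x - z](subrKA y); exact: seminormD. Qed.
Lemma seminorm_le x y : q x <= q y + q (x - y).
Proof. by rewrite addrC -{1}[x](subrK y); exact: seminormD. Qed.
Lemma seminormB x y : q (x - y) <= q x + q y.
Proof. by rewrite -(seminormN y); exact: seminormD. Qed.

End SeminormTheory.

(** Closure for the pseudometric of [q]. The seminorm is a parameter because [q] and its quotients
    [qdist q L] live on the same space. A [q]-closed set contains, with a point, its whole class
    modulo the kernel of [q]. *)
Definition closure_for q L : set V :=
  [set x | forall e : R, 0 < e -> exists2 l, L l & q (x - l) < e].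

Definition closed_for q L := closure_for q L `<=` L.

Lemma subset_closure_for q L : seminorm q -> L `<=` closure_for q L.
Proof. by move=> hq x Lx e e0; exists x => //; rewrite subrr seminorm0. Qed.

Lemma closure_for_closed q L : seminorm q -> closed_for q (closure_for q L).
Proof.
move=> hq x hx e e0; have e2 : 0 < e / 2 by rewrite divr_gt0.
have [y hy xy] := hx _ e2; have [l Ll yl] := hy _ e2; exists l => //.
by apply: le_lt_trans (seminorm_trans hq x y l) _; rewrite [ltRHS]splitr ltrD.
Qed.

Lemma closure_for_subspace q L : seminorm q -> subspace L -> subspace (closure_for q L).
Proof.
move=> hq hL; split; first by apply: subset_closure_for => //; exact: subspace0.
move=> a x y hx hy e e0.
have a1 : 0 < `|a| + 1 by rewrite ltr_wpDl.
have [l Ll xl] := hx (e / 2 / (`|a| + 1)) ltac:(by rewrite !divr_gt0).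
have [m Lm ym] := hy (e / 2) ltac:(by rewrite divr_gt0).
exists (a *: l + m); first exact: subspaceP.
rewrite opprD addrACA -scalerBr; apply: le_lt_trans (seminormD hq _ _) _.
rewrite [ltRHS]splitr ltrD// (seminormZ hq).
move: xl; rewrite ltr_pdivlMr// mulrC; apply: le_lt_trans.
by rewrite ler_wpM2r ?seminorm_ge0// lerDl.
Qed.

(** The quotient seminorm modulo [L], kept on [V] itself so that no quotient space has to be
    formed. *)
Definition qdist q L x := inf [set q (x - l) | l in L].

Section Distance.
Variables (q : V -> R) (L : set V) (hq : seminorm q) (hL : subspace L).

Lemma qdist_le x l : L l -> qdist q L x <= q (x - l).
Proof.
move=> Ll; apply: ge_inf; last by exists l.
by exists 0 => _ [m _ <-]; exact: seminorm_ge0.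
Qed.

Lemma qdist_lt x r : qdist q L x < r -> exists2 l, L l & q (x - l) < r.
Proof.
move=> h; have [|_ [l Ll <-] hl] := inf_lt _ h; last by exists l.
by exists (q (x - 0)), 0 => //; exact: subspace0.
Qed.

Lemma qdist_ge x r : (forall l, L l -> r <= q (x - l)) -> r <= qdist q L x.
Proof. by move=> h; rewrite leNgt; apply/negP => /qdist_lt[l /h]; rewrite ltNge => ->. Qed.

Lemma qdist_le_self x : qdist q L x <= q x.
Proof. by rewrite -{2}[x]subr0; exact: qdist_le (subspace0 hL). Qed.

Lemma qdist_mem x : L x -> qdist q L x <= 0.
Proof. by move=> Lx; rewrite -(seminorm0 hq) -(subrr x); exact: qdist_le. Qed.

Lemma qdist_seminorm : seminorm (qdist q L).
Proof.
apply: seminorm_intro.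
- move=> x y; apply/ler_addgt0Pr => e e0.
  have [l Ll xl] : exists2 l, L l & q (x - l) < qdist q L x + e / 2.
    by apply: qdist_lt; rewrite ltrDl divr_gt0.
  have [m Lm ym] : exists2 l, L l & q (y - l) < qdist q L y + e / 2.
    by apply: qdist_lt; rewrite ltrDl divr_gt0.
  apply: (le_trans (qdist_le _ (subspaceD hL Ll Lm))).
  rewrite opprD addrACA (le_trans (seminormD hq _ _))//.
  by rewrite [e in leRHS]splitr addrACA lerD// ltW.
- apply/eqP; rewrite eq_le (qdist_mem (subspace0 hL)).
  by apply: qdist_ge => l _; exact: seminorm_ge0.
- move=> a x; have [->|a0] := eqVneq a 0.
    by rewrite normr0 mul0r scale0r; exact: qdist_mem (subspace0 hL).
  have a0' : 0 < `|a| by rewrite normr_gt0.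
  rewrite -ler_pdivrMl//; apply: qdist_ge => l Ll.
  by rewrite ler_pdivrMl// -(seminormZ hq) scalerBr; apply: qdist_le; exact: subspaceZ.
Qed.

Lemma qdist_eq0 x : closed_for q L -> qdist q L x <= 0 -> L x.
Proof.
by move=> Lc h; apply: Lc => e e0; apply: qdist_lt; exact: le_lt_trans e0.
Qed.

End Distance.

(** Coefficients are peeled off one generator at a time, which suits induction on [E]; dependent
    generators are harmless. *)
Fixpoint span_seq (E : seq V) : set V :=
  if E is e :: E' then [set x | exists a, span_seq E' (x - a *: e)] else [set 0].

Lemma span_seq_subspace E : subspace (span_seq E).
Proof.
elim: E => [|e E [IH0 IH]]; split => //=.
- by move=> a x y -> ->; rewrite scaler0 addr0.
- by exists 0; rewrite scale0r subr0.
- move=> a x y [b hb] [c hc]; exists (a * b + c).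
  by rewrite scalerDl opprD addrACA -scalerA -scalerBr; exact: IH.
Qed.

Lemma span_seq_cons e E : span_seq E `<=` span_seq (e :: E).
Proof. by move=> x h; exists 0; rewrite scale0r subr0. Qed.

Lemma span_seq_head e E : span_seq (e :: E) e.
Proof. by exists 1; rewrite scale1r subrr; exact: subspace0 (span_seq_subspace E). Qed.

Lemma span_seq_mem e E : e \in E -> span_seq E e.
Proof.
elim: E => //= f E IH; rewrite inE => /orP[/eqP ->|/IH h].
  exact: span_seq_head.
exact: (@span_seq_cons f E e h).
Qed.

Lemma span_seq_min E L : subspace L -> {in E, forall e, L e} -> span_seq E `<=` L.
Proof.
move=> hL; elim: E => [_ x ->|e E IH h x /= [a ha]]; first exact: subspace0.
rewrite -[x](subrK (a *: e)); apply: subspaceD => //.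
  by apply: (IH _ _ ha) => f fE; apply: h; rewrite inE fE orbT.
by apply: subspaceZ => //; apply: h; rewrite inE eqxx.
Qed.

End Seminorms.

(** * Limits along ultrafilters *)

Section Ultralimits.

(** For an ultrafilter, cluster points are limits: if the preimage of [B] were missing, its
    complement would belong to [W], and [~] [B] would have to meet [B]. *)
Lemma ultra_preimage (I : Type) (W : set_system I) (UW : UltraFilter W)
    (T : topologicalType) (f : I -> T) (p : T) (B : set T) :
  cluster (f @ W) p -> nbhs p B -> W (f @^-1` B).
Proof.
move=> fp Bp; have [//|WnB] := in_ultra_setVsetC (f @^-1` B) UW.
by have [x []] := fp (~` B) B WnB Bp.
Qed.

Lemma ultra_bounded_lim (R : realType) (I : Type) (W : set_system I)
    (UW : UltraFilter W) (a : I -> R) (B : R) : (forall i, `|a i| <= B) ->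
  exists r, forall e : R, 0 < e -> W [set i | `|a i - r| < e].
Proof.
move=> aB; have [r [_ ar]] : `[- B, B]%classic `&` cluster (a @ W) !=set0.
  apply: segment_compact.
  suff : W (a @^-1` `[- B, B]) by [].
  by apply: filterS (@filterT _ W _) => i _; rewrite /= in_itv/= -ler_norml.
exists r => e e0; have re := nbhsx_ballx r e e0.
apply: filterS (ultra_preimage UW ar re) => i.
by rewrite /= /ball /= distrC.
Qed.

Lemma ultra_oo_nat :
  exists2 W : set_system nat, UltraFilter W & forall n, W [set m | (n <= m)%N].
Proof.
have [W [UW hW]] := ultraFilterLemma (eventually_filter : ProperFilter \oo).
by exists W => // n; apply: hW; exists n.
Qed.

Lemma ultra_pinfty (R : realType) :
  exists2 W : set_system R, UltraFilter W & forall s, W [set t | s <= t].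
Proof.
have [W [UW hW]] := ultraFilterLemma (@proper_pinfty_nbhs R).
by exists W => // s; apply: hW; apply: nbhs_pinfty_ge; exact: num_real.
Qed.

Lemma bounded_cluster_seq (R : realType) (a : nat -> R) (B : R) :
    (forall n, `|a n| <= B) ->
  exists r, forall e : R, 0 < e -> forall n, exists2 m, (n <= m)%N & `|a m - r| < e.
Proof.
move=> aB; have [W UW hW] := ultra_oo_nat.
have [r hr] := ultra_bounded_lim UW aB.
by exists r => e /hr h n; have [m [nm ham]] := filter_ex (filterI (hW n) h); exists m.
Qed.

End Ultralimits.

Section FiniteSpan.
Variables (R : realType) (V : lmodType R) (q : V -> R) (hq : seminorm q).

(** Bolzano-Weierstrass in the span of [E], up to the kernel of [q]. The index type is arbitrary:
    sequences serve in the induction, orbits indexed by [R] later. *)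
Let ultra_lim_span E := forall (I : Type) (W : set_system I), UltraFilter W ->
  forall (z : I -> V) (B : R), (forall i, span_seq E (z i)) -> (forall i, q (z i) <= B) ->
  exists2 y, span_seq E y & forall e : R, 0 < e -> W [set i | q (z i - y) < e].

(** Approximants within [1/(n+1)] of [x] are bounded by [q x + 1], and their ultralimit is at
    distance 0 from [x]. The limit property is a hypothesis because its own inductive proof calls
    this lemma. *)
Let closure_span E : ultra_lim_span E -> forall x, closure_for q (span_seq E) x ->
  exists2 w, span_seq E w & q (x - w) = 0.
Proof.
move=> hE x hx; have [W UW hW] := ultra_oo_nat.
have /choice[z hz] : forall n : nat, exists w, span_seq E w /\ q (x - w) < n.+1%:R^-1.
  by move=> n; have [|w ? ?] := hx n.+1%:R^-1; [rewrite invr_gt0|exists w].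
have zB n : q (z n) <= q x + 1.
  rewrite (le_trans (seminorm_le hq _ x))// lerD2l (seminormC hq) ltW//.
  by rewrite (lt_le_trans (hz n).2)// invf_le1// ler1n.
have [y yE hy] := hE _ _ UW z _ (fun n => (hz n).1) zB.
exists y => //; apply/eqP; rewrite eq_le (seminorm_ge0 hq) andbT.
apply/ler_addgt0Pr => e e0; rewrite add0r.
have e2 : 0 < e / 2 by rewrite divr_gt0.
have [N hN] : exists N : nat, N.+1%:R^-1 < e / 2.
  exists (Num.truncn (e / 2)^-1); rewrite invf_plt ?posrE//.
  by rewrite truncnS_gt.
have [n [nN ny]] := filter_ex (filterI (hW N) (hy _ e2)).
apply: (le_trans (seminorm_trans hq x (z n) y)); rewrite [leRHS]splitr ltW// ltrD//.
apply: lt_trans (hz n).2 (le_lt_trans _ hN).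
by rewrite lef_pV2 ?posrE// ler_nat ltnS.
Qed.

Lemma ultra_span_lim E : ultra_lim_span E.
Proof.
elim: E => [|e E IH] I W UW z B hz hB.
  exists 0 => //= r r0; apply: filterS (@filterT _ W _) => i _ /=.
  by rewrite (hz i) subr0 (seminorm0 hq).
have /choice[a ha] : forall i, exists a, span_seq E (z i - a *: e) by [].
have hE := span_seq_subspace E.
(* If [e] is in the [q]-closure of the span of the tail, some [w] of that span at distance 0
   replaces it and the induction hypothesis applies. Otherwise its positive distance [d] to that
   span bounds the coefficients of [e] by [B / d]. *)
have [/(closure_span IH)[w wE ew]|] := pselect (closure_for q (span_seq E) e).
  pose z' i := z i - a i *: e + a i *: w.
  have zz' i : q (z i - z' i) = 0.
    rewrite /z' -addrA opprD addrA subrr add0r opprD opprK -scalerBr.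
    by rewrite (seminormZ hq) ew mulr0.
  have z'E i : span_seq E (z' i).
    by apply: (subspaceD hE) => //; exact: subspaceZ.
  have z'B i : q (z' i) <= B.
    by rewrite (le_trans (seminorm_le hq _ (z i)))// (seminormC hq) zz' addr0.
  have [y yE hy] := IH _ _ UW z' B z'E z'B.
  exists y; first exact: span_seq_cons.
  move=> r /hy; apply: filterS => i /=; apply: le_lt_trans.
  by rewrite (le_trans (seminorm_trans hq _ (z' i) _))// zz' add0r.
move=> /existsNP[d /not_implyP[d0 hd]].
have {}hd w : span_seq E w -> d <= q (e - w).
  by move=> wE; rewrite leNgt; apply/negP => ed; apply: hd; exists w.
have aB i : `|a i| <= B / d.
  rewrite ler_pdivlMr// (le_trans _ (hB i))//.
  have [->|ai0] := eqVneq (a i) 0; first by rewrite normr0 mul0r seminorm_ge0.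
  have -> : z i = a i *: (e - - (a i)^-1 *: (z i - a i *: e)).
    by rewrite scaleNr opprK scalerDr scalerA mulfV// scale1r addrC subrK.
  by rewrite (seminormZ hq) ler_wpM2l// hd//; exact: subspaceZ.
have [r hr] := ultra_bounded_lim UW aB.
pose v i := z i - a i *: e.
have vB i : q (v i) <= B + B / d * q e.
  rewrite (le_trans (seminormB hq _ _))// lerD// (seminormZ hq) ler_wpM2r//.
  exact: seminorm_ge0.
have [y yE hy] := IH _ _ UW v _ ha vB.
exists (r *: e + y); first by exists r; rewrite addrC addKr.
move=> s s0; have s2 : 0 < s / 2 by rewrite divr_gt0.
have e1 : 0 < q e + 1 by rewrite ltr_wpDl// seminorm_ge0.
apply: filterS (filterI (hr (s / 2 / (q e + 1)) (divr_gt0 s2 e1)) (hy _ s2)) => i /= [h1 h2].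
have -> : z i - (r *: e + y) = (a i - r) *: e + (v i - y).
  by rewrite /v scalerBl opprD addrACA [a i *: e + _]addrC -!addrA addKr addrCA.
apply: (le_lt_trans (seminormD hq _ _)); rewrite [ltRHS]splitr ltrD// (seminormZ hq).
move: h1; rewrite ltr_pdivlMr//; apply: le_lt_trans.
by rewrite ler_wpM2l// lerDl.
Qed.

Lemma closure_span_seq E x : closure_for q (span_seq E) x ->
  exists2 w, span_seq E w & q (x - w) = 0.
Proof. exact: closure_span (@ultra_span_lim E) x. Qed.

End FiniteSpan.

(** * Approximate rotations of an isometry *)

Section RootsOfUnity.
Variable F : numClosedFieldType.

(** [X^n - 1] is separable in characteristic 0, so it has [n] distinct roots, one of which must be
    primitive. *)
Lemma prim_root_exists n : (0 < n)%N -> exists z : F, n.-primitive_root z.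
Proof.
move=> n0; pose p : {poly F} := 'X^n - 1; have [r Dp] := closed_field_poly_normal p.
rewrite (monicP _) ?monicXnsubC // scale1r in Dp.
have rn1 : all n.-unity_root r by apply/allP => z; rewrite -root_prod_XsubC -Dp.
have sz_r : (n < (size r).+1)%N.
  by rewrite -(size_prod_XsubC r id) -Dp size_XnsubC.
have [|z] := hasP (has_prim_root n0 rn1 _ sz_r); last by exists z.
by rewrite -separable_prod_XsubC -Dp separable_Xn_sub_1 // pnatr_eq0 -lt0n.
Qed.

Lemma norm_unity_root n (z : F) : (0 < n)%N -> z ^+ n = 1 -> `|z| = 1.
Proof.
move=> n0 zn; apply/eqP; rewrite -(@pexpr_eq1 _ _ n)// -normrX zn normr1//.
Qed.

(** If [z^e] is not 1, the geometric sum is annihilated by the nonzero factor [z^e - 1]. *)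
Lemma sum_prim_root n (z : F) e : n.-primitive_root z ->
  \sum_(k < n) (z ^+ k) ^+ e = if (n %| e)%N then n%:R else 0.
Proof.
move=> zn; under eq_bigr do rewrite -exprM mulnC exprM.
rewrite (prim_order_dvd zn); case: eqP => [->|/eqP ze].
  by under eq_bigr do rewrite expr1n; rewrite sumr_const card_ord.
have : z ^+ e != 1 by [].
rewrite -subr_eq0 => ze1; apply: (mulfI ze1).
by rewrite mulr0 -subrX1 -exprM mulnC exprM (prim_expr_order zn) expr1n subrr.
Qed.

End RootsOfUnity.

Section FejerSum.
Variables (F : numClosedFieldType) (Z : lmodType F) (u : {linear Z -> Z}).

(** The quotient [(u^n - l^n) / (u - l)] applied to [z]. *)
Definition geom_sum n (l : F) (z : Z) := \sum_(j < n) l ^+ (n.-1 - j) *: iter j u z.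

Lemma iterZ_lin j a z : iter j u (a *: z) = a *: iter j u z.
Proof. by elim: j => //= j ->; rewrite linearZ. Qed.

Lemma iter_sum_lin j (I : finType) (f : I -> Z) :
  iter j u (\sum_i f i) = \sum_i iter j u (f i).
Proof. by elim: j => //= j ->; rewrite linear_sum. Qed.

Lemma geom_sum_telescope n l z :
  u (geom_sum n l z) - l *: geom_sum n l z = iter n u z - l ^+ n *: z.
Proof.
pose f j := l ^+ (n - j) *: iter j u z.
have -> : iter n u z - l ^+ n *: z = f n - f 0%N by rewrite /f subnn expr0 scale1r subn0.
rewrite -(telescope_sumr f (leq0n n)) sumrB !big_mkord; congr (_ - _).
  rewrite linear_sum; apply: eq_bigr => j _; rewrite linearZ /f /= -subn1 -subnDA.
  by rewrite add1n.
rewrite /geom_sum scaler_sumr; apply: eq_bigr => j _; rewrite scalerA -exprS /f.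
by congr (_ ^+ _ *: _); have := ltn_ord j; lia.
Qed.

(* The square is essential, as for the Fejer kernel: its coefficient at [u^(n-1)] is
   [n], while the coefficients of [geom_sum] alone have modulus [1]. *)
Lemma fejer_identity n (z : F) x : (2 * n).-primitive_root z ->
  \sum_(k < 2 * n) (z ^+ k) ^+ n.+1 *: geom_sum n (z ^+ k) (geom_sum n (z ^+ k) x)
  = (2 * n * n)%:R *: iter n.-1 u x.
Proof.
move=> zn.
have E (k : 'I_(2 * n)) :
    (z ^+ k) ^+ n.+1 *: geom_sum n (z ^+ k) (geom_sum n (z ^+ k) x) =
    \sum_(j < n) \sum_(l < n)
      (z ^+ k) ^+ (n.+1 + (n.-1 - j) + (n.-1 - l)) *: iter (j + l) u x.
  rewrite {1}/geom_sum scaler_sumr; apply: eq_bigr => j _.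
  rewrite scalerA -exprD iter_sum_lin scaler_sumr; apply: eq_bigr => l _.
  by rewrite iterZ_lin scalerA -exprD iterD.
under eq_bigr do rewrite E; rewrite exchange_big/=.
have E2 (j : 'I_n) : \sum_(k < 2 * n) \sum_(l < n)
      (z ^+ k) ^+ (n.+1 + (n.-1 - j) + (n.-1 - l)) *: iter (j + l) u x
    = (2 * n)%:R *: iter n.-1 u x.
  have jn := ltn_ord j; have jn' : (n.-1 - j < n)%N by lia.
  (* The exponent of [z^k] is [3n-1-j-l], between [n+1] and [3n-1]. The only multiple of [2n] in
     this range is [2n], so only [l = n-1-j] survives the sum over [k]. *)
  rewrite exchange_big/= (bigD1 (Ordinal jn'))//= -scaler_suml sum_prim_root//.
  have -> : (n.+1 + (n.-1 - j) + (n.-1 - (n.-1 - j)) = 2 * n)%N by lia.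
  rewrite dvdnn subnKC ?big1 ?addr0//; last by lia.
  move=> l lj; rewrite -scaler_suml sum_prim_root// ifF ?scale0r//.
  apply/negP => /dvdnP[[|[|m]]] h; have ln := ltn_ord l; [by lia| |by nia].
  by move: lj; rewrite -val_eqE/=; apply/negP; rewrite negbK; apply/eqP; lia.
under eq_bigr do rewrite E2.
by rewrite sumr_const card_ord -scaler_nat scalerA -natrM mulnC.
Qed.

(** If [u - l] is bounded below by [c], telescoping bounds [geom_sum n l] by [3 / c] uniformly in
    [n]. The Fejer identity then gives [2n * n * N x <= 2n * 2 * (3 / c)^2 * N x]. The factor 2 in
    the hypothesis on unimodular scalars allows an [N] that is not homogeneous for complex
    scalars. *)
Lemma fejer_bound (R : realFieldType) (N : Z -> R) (P : set Z) (c : R) (n : nat) (x : Z) :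
  (forall z z', N (z + z') <= N z + N z') ->
  (forall m z, N (m%:R *: z) = m%:R * N z) ->
  (forall l z, `|l| = 1 -> N (l *: z) <= 2 * N z) ->
  (forall z, N (u z) = N z) ->
  subspace P -> (forall z, P z -> P (u z)) ->
  (forall l z, `|l| = 1 -> P z -> c * N z <= N (u z - l *: z)) ->
  0 < c -> (0 < n)%N -> P x -> 0 < N x -> n%:R <= 18 / c ^+ 2.
Proof.
move=> ND NM NZ Nu hP Pu hc c0 n0 Px Nx.
have Niter j z : N (iter j u z) = N z by elim: j => //= j <-.
have Piter j z : P z -> P (iter j u z) by move=> Pz; elim: j => //= j /Pu.
have Psum l z : P z -> P (geom_sum n l z).
  move=> Pz; apply: big_ind => [|a b|j _]; first exact: subspace0.
    exact: subspaceD.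
  by apply: subspaceZ => //; exact: Piter.
have [r rn] : exists z : F, (2 * n).-primitive_root z.
  by apply: prim_root_exists; lia.
have rk (k : nat) m : `|(r ^+ k) ^+ m| = 1.
  rewrite !normrX (@norm_unity_root _ (2 * n)) ?expr1n//; first by lia.
  exact: prim_expr_order.
have rk1 k : `|r ^+ k| = 1 by have := rk k 1%N; rewrite expr1.
have step k z : P z -> N (geom_sum n (r ^+ k) z) <= 3 / c * N z.
  move=> Pz; rewrite mulrAC ler_pdivlMr// mulrC.
  apply: le_trans (hc _ _ (rk1 k) (Psum _ _ Pz)) _.
  rewrite geom_sum_telescope; apply: (le_trans (ND _ _)); rewrite Niter.
  rewrite -scaleNr; have := NZ (- (r ^+ k) ^+ n) z; rewrite normrN => /(_ (rk k n)).
  by move=> h; rewrite (_ : 3 * N z = N z + 2 * N z) ?lerD2l//; ring.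
have Nsum (I : finType) (f : I -> Z) : N (\sum_i f i) <= \sum_i N (f i).
  apply: (big_ind2 (fun a b => N a <= b)) => //.
    by have := NM 0%N x; rewrite scale0r mul0r => ->.
  by move=> a a' b b' ha hb; apply: (le_trans (ND _ _)); exact: lerD.
have h : (2 * n * n)%:R * N x <= \sum_(k < 2 * n) 2 * ((3 / c) * ((3 / c) * N x)).
  rewrite -[in leLHS](Niter n.-1) -NM -(fejer_identity x rn) (le_trans (Nsum _ _))//.
  apply: ler_sum => k _; apply: (le_trans (NZ _ _ (rk _ _))); rewrite ler_wpM2l//.
  apply: (le_trans (step _ _ (Psum _ _ Px))); rewrite ler_wpM2l ?step//.
  by rewrite divr_ge0// ltW.
move: h; rewrite sumr_const card_ord -[_ *+ (2 * n)]mulr_natl natrM -mulrA.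
rewrite ler_pM2l ?ltr0n; last by lia.
rewrite (_ : 2 * (3 / c * (3 / c * N x)) = 18 / c ^+ 2 * N x) ?ler_pM2r//.
by field; rewrite gt_eqF.
Qed.

End FejerSum.

(** A separate name for the product, so that it can carry the complex scalar action [cplx_scale] in
    place of the componentwise real one. *)
Definition cplx (V : Type) : Type := (V * V)%type.

Section Complexification.
Variables (R : rcfType) (V : lmodType R).

HB.instance Definition _ := GRing.Zmodule.copy (cplx V) (V * V)%type.

Definition cplx_scale (z : R[i]) (p : cplx V) : cplx V :=
  (complex.Re z *: p.1 - complex.Im z *: p.2, complex.Re z *: p.2 + complex.Im z *: p.1).

Let cplx_scaleA a b p : cplx_scale a (cplx_scale b p) = cplx_scale (a * b) p.
Proof.
case: a b p => [a a'] [b b'] [x y]; rewrite /cplx_scale /=; congr pair.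
  rewrite scalerBr scalerDr !scalerA scalerBl scalerDl !opprD.
  by rewrite -!addrA; congr (_ + _); rewrite [RHS]addrC -addrA.
rewrite scalerDr scalerBr !scalerA scalerBl scalerDl.
by rewrite -!addrA; congr (_ + _); rewrite [RHS]addrC -addrA.
Qed.

Let cplx_scale1 : left_id 1 cplx_scale.
Proof. by case=> x y; rewrite /cplx_scale /= !scale1r !scale0r subr0 addr0. Qed.

Let cplx_scaleDr : right_distributive cplx_scale +%R.
Proof.
move=> [a b] [x y] [x' y']; rewrite /cplx_scale /=; congr pair => /=.
  by rewrite !scalerDr opprD addrACA.
by rewrite !scalerDr addrACA.
Qed.

Let cplx_scaleDl p : {morph cplx_scale^~ p : a b / a + b}.
Proof.
move=> [a a'] [b b']; case: p => [x y]; rewrite /cplx_scale /=; congr pair => /=.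
  by rewrite !scalerDl opprD addrACA.
by rewrite !scalerDl addrACA.
Qed.

HB.instance Definition _ := GRing.Zmodule_isLmodule.Build R[i] (cplx V)
  cplx_scaleA cplx_scale1 cplx_scaleDr cplx_scaleDl.

Variable u : {linear V -> V}.

Definition cplx_map (p : cplx V) : cplx V := (u p.1, u p.2).

Let cplx_map_linear : linear cplx_map.
Proof.
move=> [a b] [x y] [x' y']; rewrite /cplx_map; congr pair => /=.
  by rewrite linearD linearB !linearZ.
by rewrite linearD linearD !linearZ.
Qed.

HB.instance Definition _ := GRing.isLinear.Build R[i] (cplx V) (cplx V) _ cplx_map
  cplx_map_linear.

End Complexification.

(** * Approximate kernel vectors of real quadratics in an isometry *)

Section ApproximateRotation.
Variables (R : realType) (V : lmodType R) (q : V -> R) (hq : seminorm q).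
Variables (u : {linear V -> V}) (P : set V).
Hypotheses (hu : forall x, q (u x) = q x) (hP : subspace P).
Hypothesis (uP : forall x, P x -> P (u x)).

(** Homogeneous for real scalars only: a scalar of modulus 1 may double it, which is what
    [fejer_bound] tolerates. *)
Let N (p : cplx V) := q p.1 + q p.2.

Let ND p p' : N (p + p') <= N p + N p'.
Proof. by rewrite /N addrACA lerD// seminormD. Qed.

Let NZr (r : R) p : N (r%:C%C *: p) = `|r| * N p.
Proof.
by rewrite /N /= !scale0r subr0 addr0 !(seminormZ hq) -mulrDr.
Qed.

Let normc_le1 (l : R[i]) : `|l| = 1 -> `|complex.Re l| <= 1 /\ `|complex.Im l| <= 1.
Proof.
move=> l1; have h : complex.Re l ^+ 2 + complex.Im l ^+ 2 = 1.
  by have := add_Re2_Im2 l; rewrite l1 expr1n => /complexI.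
have a0 := sqr_ge0 (complex.Re l); have b0 := sqr_ge0 (complex.Im l).
by split; rewrite -(@expr_le1 _ 2)// real_normK ?num_real// -h ?lerDl ?lerDr.
Qed.

Let NZ l p : `|l| = 1 -> N (l *: p) <= 2 * N p.
Proof.
move=> /normc_le1[a1 b1]; rewrite /N /=.
have h x : `|complex.Re l| * q x + `|complex.Im l| * q x <= 2 * q x.
  by rewrite -mulrDl ler_wpM2r ?seminorm_ge0// (_ : 2 = 1 + 1)// lerD.
rewrite (le_trans (lerD (seminormB hq _ _) (seminormD hq _ _)))//.
rewrite !(seminormZ hq) mulrDr (le_trans _ (lerD (h _) (h _)))//.
by rewrite le_eqVlt; apply/orP; left; apply/eqP; ring.
Qed.

(** If all quadratics [u^2 - 2 a u + 1] with [|a| <= 1] were bounded below by [d] on [P], then, by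
    factoring them over the complex numbers, [u - l] would be bounded below by [d / 3] for every
    unimodular [l], and [fejer_bound] would bound every [n]. *)
Lemma approximate_rotation (d : R) (x : V) : 0 < d -> P x -> 0 < q x ->
  exists c, `|c| <= 1 /\ exists y, [/\ P y, 0 < q y &
    q (u (u y) - (2 * c) *: u y + y) < d * q y].
Proof.
move=> d0 Px qx; apply: contrapT => H.
have {}H (a : R) y : `|a| <= 1 -> P y -> d * q y <= q (u (u y) - (2 * a) *: u y + y).
  move=> a1 Py; have [|qy] := leP (q y) 0.
    move=> qy; rewrite (le_trans _ (seminorm_ge0 hq _))//.
    by rewrite mulr_ge0_le0// ltW.
  rewrite leNgt; apply/negP => hy; apply: H; exists a; split => //.
  by exists y.
pose U : {linear cplx V -> cplx V} := cplx_map u.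
pose Q : set (cplx V) := [set p | P p.1 /\ P p.2].
have NU p : N (U p) = N p by rewrite /N /= !hu.
have hQ : subspace Q.
  split; first by split; exact: subspace0.
  move=> [a b] [y z] [y' z'] [/= Py Pz] [Py' Pz']; split => /=.
    by apply: subspaceD => //; apply: subspaceB => //; exact: subspaceZ.
  by apply: subspaceD => //; apply: subspaceD => //; exact: subspaceZ.
have UQ p : Q p -> Q (U p) by case=> ? ?; split; exact: uP.
have lower l p : `|l| = 1 -> Q p -> d / 3 * N p <= N (U p - l *: p).
  move=> l1 [P1 P2]; have [a1 _] := normc_le1 l1.
  set w := U p - l *: p.
  have Ew : U w - l^*%C *: w = U (U p) - ((2 * complex.Re l)%:C%C) *: U p + p.
    rewrite /w linearB linearZ /= scalerBr scalerA [_^*%C * _]mulrC -sqr_normc l1 expr1n scale1r.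
    rewrite opprB addrA addrAC; congr (_ + _); rewrite -addrA -opprD -scalerDl addcJ.
    by rewrite rmorphM rmorph_nat.
  rewrite mulrAC ler_pdivrMr//.
  have h1 : N (U w - l^*%C *: w) <= N w * 3.
    rewrite (le_trans (ND _ _))// NU -scaleNr.
    have := @NZ (- l^*%C) w; rewrite normrN normcJ => /(_ l1) h.
    by rewrite (_ : N w * 3 = N w + 2 * N w) ?lerD2l//; ring.
  apply: le_trans h1; rewrite Ew /N /= !scale0r subr0 addr0 mulrDr.
  by rewrite lerD//; exact: H.
have d3 : 0 < d / 3 by rewrite divr_gt0.
have qx0 : 0 < N (x, 0) by rewrite /N /= (seminorm0 hq) addr0.
have Qx0 : Q (x, 0) by split => //; exact: subspace0.
have NM (m : nat) p : N (m%:R *: p) = m%:R * N p.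
  by rewrite -(rmorph_nat (real_complex R)) NZr normr_nat.
pose n := (Num.truncn (18 / (d / 3) ^+ 2)).+1.
have := fejer_bound ND NM NZ NU hQ UQ lower d3 (ltn0Sn _ : (0 < n)%N) Qx0 qx0.
by rewrite leNgt truncnS_gt.
Qed.

End ApproximateRotation.

(** * Isometric semigroups returning to a compact set *)

Lemma inv_nat_small (R : archiRealFieldType) (e : R) : 0 < e ->
  exists N : nat, forall m, (N <= m)%N -> m.+1%:R^-1 < e.
Proof.
move=> e0; exists (Num.truncn e^-1) => m Nm; rewrite invf_plt ?posrE//.
by rewrite (lt_le_trans (truncnS_gt _))// ler_nat.
Qed.

Section SeminormLimits.
Variables (R : realType) (V : lmodType R) (q : V -> R) (hq : seminorm q).

Lemma seminorm_limit (r : R) (k : V) :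
  (forall e : R, 0 < e -> exists2 z, q z = r & q (z - k) < e) -> q k = r.
Proof.
move=> h; apply/eqP; rewrite eq_le; apply/andP; split; apply/ler_addgt0Pr => e e0.
  have [z zr zk] := h e e0.
  by rewrite (le_trans (seminorm_le hq k z))// zr lerD2l (seminormC hq) ltW.
have [z zr zk] := h e e0.
by rewrite -zr (le_trans (seminorm_le hq z k))// lerD2l ltW.
Qed.

Lemma seminorm_small0 (x : V) : (forall e : R, 0 < e -> q x <= e) -> q x = 0.
Proof.
move=> h; apply/eqP; rewrite eq_le (seminorm_ge0 hq) andbT.
by apply/ler_addgt0Pr => e e0; rewrite add0r h.
Qed.

Lemma seminorm_rescale (L : set V) (r : R) : subspace L -> 0 <= r ->
  (exists2 x, L x & 0 < q x) -> exists2 x, L x & q x = r.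
Proof.
move=> hL r0 [x Lx qx]; exists ((r / q x) *: x); first exact: subspaceZ.
rewrite (seminormZ hq) ger0_norm ?divr_ge0// ?(ltW qx)//.
by rewrite divfK// gt_eqF.
Qed.

Lemma closed_for_eq0 (L : set V) x y : closed_for q L -> L y -> q (x - y) = 0 -> L x.
Proof. by move=> Lc Ly xy; apply: Lc => e e0; exists y; rewrite ?xy. Qed.

Lemma closure_for_map (f : {linear V -> V}) (L M : set V) :
  (forall x, q (f x) = q x) -> (forall x, L x -> closure_for q M (f x)) ->
  forall x, closure_for q L x -> closure_for q M (f x).
Proof.
move=> hf h x hx; apply: (closure_for_closed hq) => e /hx[l Ll xl].
by exists (f l); [exact: h|rewrite -linearB hf].
Qed.

Lemma span_map_subspace (f : {linear V -> V}) (E : seq V) (M : set V) :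
  subspace M -> {in E, forall x, M (f x)} -> forall x, span_seq E x -> M (f x).
Proof.
move=> hM h; apply: (@span_seq_min _ _ E [set x | M (f x)]) => //.
split; first by rewrite /= linear0; exact: subspace0.
by move=> a x y Mx My; rewrite /= linearP; exact: subspaceP.
Qed.

End SeminormLimits.

Section RotationDefect.
Variables (R : comNzRingType) (V : lmodType R) (U : R -> {linear V -> V}).

(** When [c] is the cosine of an angle, this is the real form of the product of [U t - l] over the
    two conjugate unimodular numbers [l] with real part [c]. *)
Definition rotation_defect (c t : R) (x : V) := U t (U t x) - (2 * c) *: U t x + x.

Let rotation_defect_linear c t : linear (rotation_defect c t).
Proof.
move=> a x y; rewrite /rotation_defect !(linearP (U t)) !scalerDr opprD scalerN !scalerA.
by rewrite [2 * c * a]mulrC [_ + _ + (- _ - _)]addrACA [LHS]addrACA.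
Qed.

HB.instance Definition _ c t :=
  GRing.isLinear.Build R V V _ (rotation_defect c t) (rotation_defect_linear c t).

End RotationDefect.

(* Nothing is required of the cluster point in [hs_cluster], not even to lie in [K],
   so that the same [K] serves for [q] and for all its quotients [qdist q L]. *)
Record hitting_system (R : realType) (V : lmodType R) (q : V -> R)
    (U : R -> {linear V -> V}) (K : set V) : Prop := HittingSystem {
  hs_seminorm : seminorm q;
  hs0 : forall x, U 0 x = x;
  hsD : forall s t x, 0 <= s -> 0 <= t -> U (s + t) x = U s (U t x);
  hs_isometry : forall t x, 0 <= t -> q (U t x) = q x;
  hs_continuous : forall x (e : R), 0 < e ->
    exists2 d, 0 < d & forall t, 0 <= t -> t < d -> q (U t x - x) < e;
  hs_cluster : forall k : nat -> V, (forall n, K (k n)) ->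
    exists x, forall e : R, 0 < e -> forall n, exists2 m, (n <= m)%N & q (k m - x) < e;
  hs_hit : forall x (e s : R), q x < 1 -> 0 < e ->
    exists t k, [/\ s <= t, 0 <= t, K k & q (U t x - k) < e] }.

Section HittingSystem.
Variables (R : realType) (V : lmodType R) (q : V -> R).
Variables (U : R -> {linear V -> V}) (K : set V) (hs : hitting_system q U K).

Let hq : seminorm q := hs_seminorm hs.

Lemma hsC s t x : 0 <= s -> 0 <= t -> U s (U t x) = U t (U s x).
Proof. by move=> s0 t0; rewrite -!(hsD hs)// addrC. Qed.

(** Two visits near the same cluster point, at times at least [|s|] apart, are compared; isometry
    removes the earlier time. The four distances through the two hit points and the cluster point
    explain [e / 4]. *)
Let recurrent_lt1 x (e s : R) : q x < 1 -> 0 < e ->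
  exists t, [/\ s <= t, 0 <= t & q (U t x - x) < e].
Proof.
move=> x1 e0; have e4 : 0 < e / 4 by rewrite divr_gt0.
have /choice[p hp] : forall n : nat, exists p : R * V,
    [/\ n%:R <= p.1, 0 <= p.1, K p.2 & q (U p.1 x - p.2) < e / 4].
  by move=> n; have [t [k ?]] := hs_hit hs n%:R x1 e4; exists (t, k).
have Kp n : K (p n).2 by have [] := hp n.
have [z hz] := hs_cluster hs Kp.
have [m _ mz] := hz _ e4 0%N.
have [m' mm' m'z] := hz _ e4 (Num.truncn ((p m).1 + `|s|)).+1.
have [_ tm0 _ hm] := hp m; have [tm' tm'0 _ hm'] := hp m'.
have h : (p m).1 + `|s| <= (p m').1.
  rewrite (le_trans _ tm')// (le_trans (ltW (truncnS_gt _)))//.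
  by rewrite ler_nat.
set d := (p m').1 - (p m).1; have sd : `|s| <= d by rewrite lerBrDl.
have d0 : 0 <= d := le_trans (normr_ge0 s) sd.
exists d; split => //; first exact: le_trans (ler_norm s) sd.
rewrite -(hs_isometry hs _ tm0) linearB -(hsD hs)//= /d addrCA subrr addr0.
have h1 := seminorm_trans hq (U (p m').1 x) (p m').2 (U (p m).1 x).
have h2 := seminorm_trans hq (p m').2 z (U (p m).1 x).
have h3 := seminorm_trans hq z (p m).2 (U (p m).1 x).
have c1 := seminormC hq z (p m).2; have c2 := seminormC hq (p m).2 (U (p m).1 x).
lra.
Qed.

Lemma hs_recurrent x (e s : R) : 0 < e ->
  exists t, [/\ s <= t, 0 <= t & q (U t x - x) < e].
Proof.
move=> e0; pose r := q x + 1; have r0 : 0 < r by rewrite ltr_wpDl// seminorm_ge0.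
have [||t [st t0 h]] := @recurrent_lt1 (r^-1 *: x) (e / r) s.
- rewrite (seminormZ hq) gtr0_norm ?invr_gt0// mulrC ltr_pdivrMr// mul1r.
  by rewrite ltrDl.
- by rewrite divr_gt0.
exists t; split => //; move: h.
rewrite linearZ -scalerBr (seminormZ hq) gtr0_norm ?invr_gt0// mulrC.
by rewrite ltr_pM2r// invr_gt0.
Qed.

(** Passage to the quotient by [L]. For hitting, a representative [x - l] in the [q]-unit ball is
    followed, and [U t l] stays in [L]. The isometry property is the point that needs recurrence. *)
Lemma hs_qdist (L : set V) : subspace L -> (forall t x, 0 <= t -> L x -> L (U t x)) ->
  hitting_system (qdist q L) U K.
Proof.
move=> hL UL; split.
- exact: qdist_seminorm.
- exact: hs0 hs.
- exact: hsD hs.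
- move=> t x t0; apply/eqP; rewrite eq_le; apply/andP; split; last first.
    apply: qdist_ge => // l Ll; apply/ler_addgt0Pr => e e0.
    (* By recurrence of [x], an element of [L] near [U t x] is moved back near [x]. *)
    have [s [ts s0 xs]] := hs_recurrent x t e0.
    have st : 0 <= s - t by rewrite subr_ge0.
    apply: (le_trans (qdist_le hq x (UL _ _ st Ll))).
    rewrite -(hs_isometry hs (U t x - l) st) linearB -(hsD hs)// subrK [leRHS]addrC.
    rewrite (le_trans (seminorm_trans hq _ (U s x) _))// lerD2r.
    by rewrite (seminormC hq) ltW.
  apply: qdist_ge => // l Ll; rewrite -(hs_isometry hs (x - l) t0) linearB.
  by apply: qdist_le => //; exact: UL.
- move=> x e e0; have [d d0 hd] := hs_continuous hs x e0; exists d => // t t0 td.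
  exact: le_lt_trans (qdist_le_self hq hL _) (hd _ t0 td).
- move=> k Kk; have [x hx] := hs_cluster hs Kk; exists x => e e0 n.
  have [m nm h] := hx e e0 n; exists m => //.
  exact: le_lt_trans (qdist_le_self hq hL _) h.
- move=> x e s /(qdist_lt hL)[l Ll xl] e0.
  have [t [k [st t0 Kk h]]] := hs_hit hs s xl e0; exists t, k; split => //.
  have -> : U t x - k = U t (x - l) - k + U t l.
    by rewrite linearB /= addrAC subrK.
  apply: (le_lt_trans (seminormD (qdist_seminorm hq hL) _ _)).
  rewrite -[e]addr0 ltr_leD//; first exact: le_lt_trans (qdist_le_self hq hL _) h.
  by apply: qdist_mem => //; exact: UL.
Qed.

(** Replaces compactness of the sphere: the [y n] themselves need not cluster, but suitable
    translates along their orbits do. The value [1/2] is a choice below the bound 1 of [hs_hit]. *)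
Lemma hs_hit_cluster (y : nat -> V) : (forall n, q (y n) = 2^-1) ->
  exists k (t : nat -> R), (forall n, 0 <= t n) /\ forall e : R, 0 < e ->
    forall n, exists2 m, (n <= m)%N & q (U (t m) (y m) - k) < e.
Proof.
move=> hy; have y1 n : q (y n) < 1 by rewrite hy invf_lt1// ltr1n.
have /choice[p hp] : forall n : nat, exists p : R * V,
    [/\ 0 <= p.1, K p.2 & q (U p.1 (y n) - p.2) < n.+1%:R^-1].
  move=> n; have n0 : 0 < n.+1%:R^-1 :> R by rewrite invr_gt0.
  by have [t [k [_ ? ? ?]]] := hs_hit hs 0 (y1 n) n0; exists (t, k).
have Kp n : K (p n).2 by have [] := hp n.
have [k hk] := hs_cluster hs Kp.
exists k, (fun n => (p n).1); split => [n|e e0 n]; first by have [] := hp n.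
have e2 : 0 < e / 2 by rewrite divr_gt0.
have [N hN] := inv_nat_small e2.
have [m nm mk] := hk _ e2 (maxn n N); move: nm; rewrite geq_max => /andP[nm Nm].
exists m => //; apply: (le_lt_trans (seminorm_trans hq _ (p m).2 _)).
rewrite [e]splitr ltrD//; have [_ _ h] := hp m.
exact: lt_trans h (hN _ Nm).
Qed.

(** The vector of seminorm [1/2] says that [W] is not inside the kernel of [q], in the normalization
    of [hs_hit_cluster]. *)
Definition invariant_subspace (W : set V) :=
  [/\ subspace W, forall t x, 0 <= t -> W x -> W (U t x), closed_for q W &
      exists2 x, W x & q x = 2^-1].

End HittingSystem.

(** * Exact kernel vectors of rotation defects *)

Section InvariantSubspaces.
Variables (R : realType) (V : lmodType R) (q : V -> R).
Variables (U : R -> {linear V -> V}) (K : set V) (hs : hitting_system q U K).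

Let hq : seminorm q := hs_seminorm hs.

Lemma rotation_defect_comm c t s x : 0 <= s -> 0 <= t ->
  rotation_defect U c t (U s x) = U s (rotation_defect U c t x).
Proof.
move=> s0 t0; rewrite /rotation_defect (linearD (U s)) (linearB (U s)) [U s (_ *: _)]linearZ /=.
by rewrite !(hsC hs _ s0 t0).
Qed.

Lemma rotation_defect_le c t x : 0 <= t ->
  q (rotation_defect U c t x) <= (2 + 2 * `|c|) * q x.
Proof.
move=> t0; rewrite /rotation_defect.
rewrite (le_trans (seminormD hq _ _))//.
rewrite (le_trans (lerD (seminormB hq _ _) (lexx _)))//.
rewrite (seminormZ hq) !(hs_isometry hs)// normrM ger0_norm//.
by rewrite le_eqVlt; apply/orP; left; apply/eqP; ring.
Qed.

Lemma rotation_defect_angle c c' t x : 0 <= t ->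
  q (rotation_defect U c t x) <= q (rotation_defect U c' t x) + 2 * `|c - c'| * q x.
Proof.
move=> t0; rewrite (le_trans (seminorm_le hq _ (rotation_defect U c' t x)))// lerD2l.
rewrite /rotation_defect opprD addrACA subrr addr0 opprB addrC subrKA.
by rewrite -scalerBl (seminormZ hq) (hs_isometry hs)// -mulrBr normrM ger0_norm// distrC.
Qed.

(** Approximate kernel vectors are translated along their orbits until they cluster. The defect
    commutes with the isometries [U s], so it stays small, and the cluster point is an exact kernel
    vector, still of seminorm [1/2]. *)
Lemma rotation_step (W : set V) t : 0 <= t -> invariant_subspace q U W ->
  exists W' c, [/\ invariant_subspace q U W', W' `<=` W &
    forall x, W' x -> q (rotation_defect U c t x) = 0].
Proof.
move=> t0 [hW UW Wc [x0 Wx0 qx0]].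
have /choice[p hp] : forall n : nat, exists p : R * V,
    [/\ `|p.1| <= 1, W p.2, q p.2 = 2^-1 & q (rotation_defect U p.1 t p.2) < n.+1%:R^-1].
  move=> n; have n0 : 0 < n.+1%:R^-1 :> R by rewrite invr_gt0.
  have [|c [c1 [y [Wy qy hy]]]] := approximate_rotation hq
    (fun x => hs_isometry hs x t0) hW (fun x => UW t x t0) n0 Wx0.
    by rewrite qx0 invr_gt0.
  (* Scaling by [r] brings the seminorm to [1/2]. *)
  pose r := (2 * q y)^-1; have r0 : 0 < r by rewrite invr_gt0 mulr_gt0.
  exists (c, r *: y); split => //=; first exact: subspaceZ.
    by rewrite (seminormZ hq) gtr0_norm// /r invfM -mulrA mulVf ?mulr1// gt_eqF.
  rewrite linearZ (seminormZ hq) gtr0_norm// mulrC.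
  apply: (@lt_trans _ _ (n.+1%:R^-1 * q y * r)); first by rewrite ltr_pM2r.
  rewrite -mulrA gtr_pMr// /r invfM mulrCA mulfV ?mulr1 ?gt_eqF//.
  by rewrite invf_lt1// ltr1n.
have p1 n : `|(p n).1| <= 1 by have [] := hp n.
have [c hc] := bounded_cluster_seq p1.
(* The cosines [(p n).1] are replaced by their cluster value [c]; on vectors of seminorm [1/2] this
   changes the defect by at most the distance of the cosines. *)
have /choice[y hy] : forall n : nat, exists y,
    [/\ W y, q y = 2^-1 & q (rotation_defect U c t y) < n.+1%:R^-1].
  move=> n; have n0 : 0 < n.+1%:R^-1 / 2 :> R by rewrite divr_gt0 ?invr_gt0.
  have [N hN] := inv_nat_small n0.
  have [m Nm mc] := hc _ n0 N; have [_ Wy qy yc] := hp m.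
  exists (p m).2; split => //.
  apply: (le_lt_trans (rotation_defect_angle c (p m).1 (p m).2 t0)).
  rewrite qy mulrAC mulfV// mul1r [ltRHS]splitr ltrD// 1?distrC//.
  exact: lt_trans yc (hN _ Nm).
have qy n : q (y n) = 2^-1 by have [] := hy n.
have [k [s [s0 hk]]] := hs_hit_cluster hs qy.
exists [set z | W z /\ q (rotation_defect U c t z) = 0], c; split; last 2 first.
- by move=> z [].
- by move=> z [].
split.
- split; first split; first exact: subspace0.
    by rewrite linear0 seminorm0.
  move=> a x y' [Wx qx] [Wy qy']; split; first exact: subspaceP.
  apply/eqP; rewrite eq_le (seminorm_ge0 hq) andbT linearP.
  by rewrite (le_trans (seminormD hq _ _))// (seminormZ hq) qx qy' mulr0 addr0.
- move=> r x r0 [Wx qx]; split; first exact: UW.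
  by rewrite rotation_defect_comm// (hs_isometry hs).
- move=> x hx; split; first by apply: Wc => e /hx[l [Wl _] xl]; exists l.
  apply: (seminorm_small0 hq) => e e0; have B0 : 0 < 2 + 2 * `|c| by rewrite ltr_wpDr.
  have [l [Wl ql] xl] := hx _ (divr_gt0 e0 B0).
  rewrite (le_trans (seminorm_le hq _ (rotation_defect U c t l)))// ql add0r.
  rewrite -linearB (le_trans (rotation_defect_le _ _ t0))// ltW//.
  by rewrite mulrC -ltr_pdivlMr.
- exists k; last first.
    apply: (seminorm_limit hq) => e e0; have [m _ hm] := hk e e0 0%N.
    by exists (U (s m) (y m)) => //; rewrite (hs_isometry hs)//; have [] := hy m.
  split.
    apply: Wc => e e0; have [m _ hm] := hk e e0 0%N.
    exists (U (s m) (y m)); first by apply: UW => //; have [] := hy m.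
    by rewrite (seminormC hq).
  apply: (seminorm_small0 hq) => e e0; have B0 : 0 < 2 + 2 * `|c| by rewrite ltr_wpDr.
  have e2 : 0 < e / 2 by rewrite divr_gt0.
  have [N hN] := inv_nat_small e2.
  have [m Nm hm] := hk _ (divr_gt0 e2 B0) N; have [_ _ ym] := hy m.
  rewrite (le_trans (seminorm_le hq _ (rotation_defect U c t (U (s m) (y m)))))//.
  rewrite [leRHS]splitr lerD//.
    rewrite rotation_defect_comm// (hs_isometry hs)// ltW//.
    exact: lt_trans ym (hN _ Nm).
  rewrite -linearB (le_trans (rotation_defect_le _ _ t0))// ltW//.
  by rewrite mulrC -ltr_pdivlMr// (seminormC hq).
Qed.

(** [rotation_step] is iterated inside the previous subspace. What must be shown is that the
    intersection of the decreasing subspaces is not swallowed by the kernel of [q]. *)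
Lemma rotation_sequence (W0 : set V) (t : nat -> R) : (forall n, 0 <= t n) ->
  invariant_subspace q U W0 -> exists W (c : nat -> R),
    invariant_subspace q U W /\
    forall n x, W x -> q (rotation_defect U (c n) (t n) x) = 0.
Proof.
move=> t0 hW0.
pose T := {W : set V | invariant_subspace q U W}.
have /choice[f hf] : forall p : nat * T, exists r : T * R,
    sval r.1 `<=` sval p.2 /\ forall x, sval r.1 x -> q (rotation_defect U r.2 (t p.1) x) = 0.
  move=> [n [W hW]]; have [W' [c [hW' W'W h]]] := rotation_step (t0 n) hW.
  by exists (exist _ W' hW', c).
pose w := fix w n : T := if n is m.+1 then (f (m, w m)).1 else exist _ W0 hW0.
pose c n := (f (n, w n)).2.
have wS n : sval (w n.+1) `<=` sval (w n) by have [] := hf (n, w n).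
have wc n x : sval (w n.+1) x -> q (rotation_defect U (c n) (t n) x) = 0.
  by have [_] := hf (n, w n); apply.
have wle n m : (n <= m)%N -> sval (w m) `<=` sval (w n).
  elim: m => [|m IH]; first by rewrite leqn0 => /eqP ->.
  by rewrite leq_eqVlt => /orP[/eqP ->//|/IH h]; apply: subset_trans h.
have good n : invariant_subspace q U (sval (w n)) := svalP (w n).
have /choice[y hy] : forall n, exists y, sval (w n) y /\ q y = 2^-1.
  by move=> n; have [_ _ _ [y]] := good n; exists y.
(* The translates of [y m] stay in the invariant subspace [w m], hence in [w n] for [n <= m]; so [k]
   lies in every closed [w n]. *)
have [k [s [s0 hk]]] := hs_hit_cluster hs (fun n => (hy n).2).
exists (\bigcap_n sval (w n)), c; split; last by move=> n x hx; apply: wc; exact: hx.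
split.
- split; first by move=> n _; have [h _ _ _] := good n; exact: subspace0.
  move=> a x z hx hz n _; have [h _ _ _] := good n.
  by apply: subspaceP => //; [exact: hx|exact: hz].
- by move=> r x r0 hx n _; have [_ h _ _] := good n; apply: h => //; exact: hx.
- move=> x hx n _; have [_ _ h _] := good n; apply: h => e /hx[l hl xl].
  by exists l => //; exact: hl.
- exists k; last first.
    apply: (seminorm_limit hq) => e e0; have [m _ hm] := hk e e0 0%N.
    by exists (U (s m) (y m)) => //; rewrite (hs_isometry hs)//; have [] := hy m.
  move=> n _; have [_ h hc _] := good n; apply: hc => e e0.
  have [m nm hm] := hk e e0 n; exists (U (s m) (y m)); last by rewrite (seminormC hq).
  by apply: h => //; apply: (wle _ _ nm); have [] := hy m.
Qed.

End InvariantSubspaces.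

(** * Finite generation modulo the kernel of [q] *)

Section FiniteGeneration.
Variables (R : realType) (V : lmodType R) (U : R -> {linear V -> V}) (K : set V).

Lemma dyadic_floor (n : nat) (t : R) : 0 <= t ->
  exists m : nat, 0 <= t - m%:R * 2^-1 ^+ n < 2^-1 ^+ n.
Proof.
move=> t0; exists (Num.truncn (t * 2 ^+ n)).
have p0 : 0 < 2 ^+ n :> R by rewrite exprn_gt0.
rewrite exprVn subr_ge0 ler_pdivrMr// ltrBlDr.
rewrite -[X in X + _]mul1r -mulrDl ltr_pdivlMr// [1 + _]addrC natr1 truncnS_gt andbT.
by rewrite truncn_le mulr_ge0// ltW.
Qed.

Lemma half_pow_small (e : R) : 0 < e -> exists N : nat, forall n, (N <= n)%N -> 2^-1 ^+ n < e.
Proof.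
move=> e0; have [N hN] := inv_nat_small e0; exists N.+1 => -[//|n] Nn.
apply: le_lt_trans (hN n Nn); rewrite exprVn lef_pV2 ?posrE ?exprn_gt0//.
by rewrite -natrX ler_nat; exact: ltnW (ltn_expl _ _).
Qed.

(** Multiples of [2^-n] are handled by the semigroup law; they approximate [t] from below, and
    strong continuity with closedness of [L] concludes. *)
Lemma hs_closed_invariant q (L : set V) (N : nat) : hitting_system q U K ->
  closed_for q L -> (forall n x, (N <= n)%N -> L x -> L (U (2^-1 ^+ n) x)) ->
  forall t x, 0 <= t -> L x -> L (U t x).
Proof.
move=> hs Lc hL t x t0 Lx.
have hm n m : (N <= n)%N -> L (U (m%:R * 2^-1 ^+ n) x).
  move=> Nn; elim: m => [|m IH]; first by rewrite mul0r (hs0 hs).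
  rewrite -natr1 mulrDl mul1r addrC (hsD hs) ?mulr_ge0 ?exprn_ge0 ?invr_ge0//.
  exact: hL.
apply: Lc => e e0; have [d d0 hd] := hs_continuous hs x e0.
have [M hM] := half_pow_small d0; pose n := maxn N M.
have [m /andP[r0 r1]] := dyadic_floor n t0.
exists (U (m%:R * 2^-1 ^+ n) x); first by apply: hm; exact: leq_maxl.
have m0 : 0 <= m%:R * 2^-1 ^+ n :> R by rewrite mulr_ge0 ?exprn_ge0 ?invr_ge0.
rewrite -{1}[t](subrKC (m%:R * 2^-1 ^+ n)) (hsD hs)// -linearB (hs_isometry hs)//.
apply: hd => //; apply: lt_trans r1 _; apply: hM; exact: leq_maxr.
Qed.

(** On the common kernel of all dyadic defects, halving the time step is solving a linear equation,
    so the span of [x] and one short translate is stable. Invariance is stated with a closure since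
    the equations hold only modulo the kernel of [q]. *)
Lemma hs_finite_invariant q : hitting_system q U K -> (exists x, 0 < q x) ->
  exists x y, 0 < q x /\ forall t z, 0 <= t ->
    span_seq [:: x; y] z -> closure_for q (span_seq [:: x; y]) (U t z).
Proof.
move=> hs [z0 qz0]; have hq := hs_seminorm hs.
have tau0 n : 0 <= 2^-1 ^+ n :> R by rewrite exprn_ge0// invr_ge0.
have [|W [c [[hW UW Wc [x Wx qx]] hc]]] := @rotation_sequence _ _ _ _ _ hs setT _ tau0.
  split => //; have [//|||x _ xr] := @seminorm_rescale _ _ _ hq setT 2^-1 _ _ _.
  - by rewrite invr_ge0.
  - by exists z0.
  by exists x.
have [N hN] : exists N : nat, forall n, (N <= n)%N -> q (U (2^-1 ^+ n) x - x) < 2^-1.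
  have h2 : 0 < 2^-1 :> R by rewrite invr_gt0.
  have [d d0 hd] := hs_continuous hs x h2; have [N hN] := half_pow_small d0.
  by exists N => n /hN h; exact: hd.
pose y := U (2^-1 ^+ N) x; exists x, y; split; first by rewrite qx invr_gt0.
have halfS n z : U (2^-1 ^+ n.+1) (U (2^-1 ^+ n.+1) z) = U (2^-1 ^+ n) z.
  by rewrite -(hsD hs)// exprS -mulrDl (_ : 2^-1 + 2^-1 = 1) ?mul1r//; field.
(* A zero cosine would mean [U (2^-n) x = - x] modulo the kernel, a displacement of seminorm
   [2 * q x = 1], while [N] keeps it below [1/2]. *)
have cN n : (N <= n)%N -> c n.+1 != 0.
  move=> Nn; apply/eqP => c0; have := hc n.+1 x Wx.
  rewrite /rotation_defect halfS c0 mulr0 scale0r subr0 => h.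
  have := seminorm_trans hq (2 *: x) (U (2^-1 ^+ n) x + x) 0.
  rewrite !subr0 h addr0 (seminormZ hq) qx ger0_norm// mulfV// scaler_nat mulr2n.
  rewrite opprD addrACA subrr addr0 (seminormC hq) => h2.
  by have h1 := hN n Nn; lra.
set S := span_seq [:: x; y]; set L := closure_for q S.
have hS : subspace S := span_seq_subspace _.
have hL : subspace L := closure_for_subspace hq hS.
have Lc : closed_for q L := closure_for_closed hq.
have Sx : S x by exact: span_seq_head.
have Sy : S y by apply: span_seq_cons; exact: span_seq_head.
have SL : S `<=` L := subset_closure_for hq.
have Wy : W y by exact: UW.
have step n z : (N <= n)%N -> W z -> L z -> L (U (2^-1 ^+ n) z) -> L (U (2^-1 ^+ n.+1) z).
  move=> Nn Wz Lz LUz.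
  have c2 : 2 * c n.+1 != 0 by rewrite mulf_neq0// cN.
  apply: (@closed_for_eq0 _ _ q L _ ((2 * c n.+1)^-1 *: (U (2^-1 ^+ n) z + z))) => //.
    by apply: (subspaceZ hL); exact: (subspaceD hL).
  have := hc n.+1 z Wz; rewrite /rotation_defect halfS.
  set v := U (2^-1 ^+ n.+1) z; set w := U (2^-1 ^+ n) z.
  have -> : w - (2 * c n.+1) *: v + z = - (2 * c n.+1) *: (v - (2 * c n.+1)^-1 *: (w + z)).
    by rewrite scalerBr scalerA mulNr mulfV// scaleN1r opprK scaleNr
      [LHS]addrAC [LHS]addrC.
  rewrite (seminormZ hq) normrN => /eqP; rewrite mulf_eq0 normr_eq0 (negbTE c2) /=.
  by move=> /eqP.
(* The defect equation at step [N] reads [U (2^-N) y = 2 c_N y - x]; it starts the induction on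
   [n]. *)
have LN : L (U (2^-1 ^+ N) y).
  have := hc N x Wx; rewrite /rotation_defect -/y => h.
  apply: (@closed_for_eq0 _ _ q L _ ((2 * c N) *: y - x)) => //.
    by apply: SL; apply: (subspaceB hS) => //; exact: (subspaceZ hS).
  by rewrite opprB addrA addrAC.
have all n : (N <= n)%N -> L (U (2^-1 ^+ n) x) /\ L (U (2^-1 ^+ n) y).
  move=> /subnK <-; elim: (n - N)%N => [|m [IHx IHy]].
    by split; [exact: SL|exact: LN].
  by rewrite addSn; split; apply: step => //; rewrite ?leq_addl//; exact: SL.
have Linv n z : (N <= n)%N -> L z -> L (U (2^-1 ^+ n) z).
  move=> /all[Lx Ly]; apply: (closure_for_map hq).
    by move=> v; exact: (hs_isometry hs v (tau0 n)).
  apply: (span_map_subspace hL) => w; rewrite !inE => /orP[/eqP ->//|/eqP ->//].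
by move=> t z t0 Sz; exact: (hs_closed_invariant hs Lc Linv t0 (SL _ Sz)).
Qed.

(** Otherwise an increasing sequence of invariant finite spans exists, each new one containing a
    vector at distance [3/4] from the previous one and within [1/8] of [K]. Two such vectors near
    the same cluster point are at distance less than [4/8], a contradiction. *)
Lemma hs_finite_generation q : hitting_system q U K ->
  exists E : seq V, forall x, closure_for q (span_seq E) x.
Proof.
move=> hs; have hq := hs_seminorm hs; apply: contrapT => H.
have e8 : 0 < 8^-1 :> R by rewrite invr_gt0.
pose cl E := closure_for q (span_seq E).
pose inv E := forall t z, 0 <= t -> cl E z -> cl E (U t z).
have hcl E : subspace (cl E) by apply: closure_for_subspace => //; exact: span_seq_subspace.
have clc E : closed_for q (cl E) := closure_for_closed hq.
have sub E : span_seq E `<=` cl E := subset_closure_for hq.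
have mono E E' : span_seq E `<=` span_seq E' -> cl E `<=` cl E'.
  by move=> h x hx e /hx[l /h]; exists l.
have next E : inv E -> exists x y, inv [:: x, y & E] /\
    exists z k, [/\ K k, cl [:: x, y & E] z, qdist q (cl E) z = 3 / 4 & q (z - k) < 8^-1].
  move=> hE; have hsL := hs_qdist hs (hcl E) hE; have hqL := hs_seminorm hsL.
  have [x0 hx0] : exists x, 0 < qdist q (cl E) x.
    apply: contrapT => h; apply: H; exists E => x.
    apply: (qdist_eq0 (hcl E) (clc E)); rewrite leNgt; apply/negP => hx.
    by apply: h; exists x.
  have [x [y [qx hxy]]] := hs_finite_invariant hsL (ex_intro _ x0 hx0).
  set E' := [:: x, y & E].
  have EE' : span_seq E `<=` span_seq E'.
    by move=> z Ez; do 2 apply: span_seq_cons.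
  have xyE' : span_seq [:: x; y] `<=` span_seq E'.
    apply: span_seq_min; first exact: span_seq_subspace.
    move=> z; rewrite !inE => /orP[/eqP ->|/eqP ->]; apply: span_seq_mem; rewrite !inE eqxx ?orbT//.
  (* Closeness to the span of [x] and [y] modulo [cl E] means closeness to a sum [l + m] with [m] in
     [cl E]. *)
  have lift z : closure_for (qdist q (cl E)) (span_seq [:: x; y]) z -> cl E' z.
    move=> hz; apply: (clc E') => e /hz[l hl zl].
    have [m Em zm] := qdist_lt (hcl E) zl.
    exists (l + m); last by rewrite opprD addrA.
    by apply: (subspaceD (hcl E')); [exact/sub/xyE'|exact: mono Em].
  have hE' : inv E'.
    move=> t z t0; apply: (closure_for_map hq).
      by move=> w; exact: (hs_isometry hs w t0).
    apply: (span_map_subspace (hcl E')) => w; rewrite !inE => /or3P[/eqP ->|/eqP ->|wE].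
    - by apply/lift/hxy => //; apply: span_seq_mem; rewrite !inE eqxx.
    - by apply/lift/hxy => //; apply: span_seq_mem; rewrite !inE eqxx orbT.
    - by apply: (mono _ _ EE'); apply: hE => //; apply: sub; exact: span_seq_mem.
  exists x, y; split => //.
  (* The value [3/4] is below 1, so that hitting applies, and above the sum [4/8] of the errors. *)
  have [||z E'z zq] := @seminorm_rescale _ _ _ hqL (cl E') (3 / 4) (hcl E').
  - by rewrite divr_ge0.
  - by exists x => //; apply: sub; exact: span_seq_head.
  have z1 : qdist q (cl E) z < 1 by rewrite zq ltr_pdivrMr// mul1r ltr_nat.
  have [l El zl] := qdist_lt (hcl E) z1.
  have [t [k [_ t0 Kk hk]]] := hs_hit hs 0 zl e8.
  (* Subtracting [l] from [cl E] and moving by [U t] keep the vector in [cl E'] and preserve its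
     quotient seminorm. *)
  exists (U t (z - l)), k; split => //.
    apply: hE' => //; apply: (subspaceB (hcl E')) => //; exact: mono El.
  rewrite (hs_isometry hsL)//; apply/eqP; rewrite eq_le -zq; apply/andP; split.
    rewrite (le_trans (seminormB hqL _ _))// -[leRHS]addr0 lerD2l.
    exact: qdist_mem.
  rewrite (le_trans (seminorm_le hqL z (z - l)))// -[leRHS]addr0 lerD2l.
  by rewrite opprB addrC subrK; exact: qdist_mem.
pose T := {E | inv E}.
have inv0 : inv [::].
  move=> t z t0; apply: (closure_for_map hq) => [w|w ->].
    exact: (hs_isometry hs w t0).
  by rewrite linear0; exact: sub.
have /choice[f hf] : forall E : T, exists E' : T, span_seq (sval E) `<=` span_seq (sval E') /\
    exists z k, [/\ K k, cl (sval E') z, qdist q (cl (sval E)) z = 3 / 4 & q (z - k) < 8^-1].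
  move=> [E hE]; have [x [y [hE' h]]] := next E hE.
  exists (exist _ _ hE'); split => //= z Ez.
  by exists 0; rewrite scale0r subr0; exact: span_seq_cons.
pose w n := iter n f (exist _ _ inv0 : T).
have wle n m : (n <= m)%N -> cl (sval (w n)) `<=` cl (sval (w m)).
  elim: m => [|m IH]; first by rewrite leqn0 => /eqP ->.
  rewrite leq_eqVlt => /orP[/eqP ->//|/IH h]; apply: subset_trans h _.
  by apply: mono; have [] := hf (w m).
have /choice[p hp] : forall n, exists p : V * V, [/\ K p.2, cl (sval (w n.+1)) p.1,
    qdist q (cl (sval (w n))) p.1 = 3 / 4 & q (p.1 - p.2) < 8^-1].
  by move=> n; have [_ [z [k ?]]] := hf (w n); exists (z, k).
have Kp n : K (p n).2 by have [] := hp n.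
have [x hx] := hs_cluster hs Kp.
have [m _ hm] := hx _ e8 0%N; have [m' mm' hm'] := hx _ e8 m.+1.
have [_ wm _ zm] := hp m; have [_ _ qm' zm'] := hp m'.
have hqL := qdist_seminorm hq (hcl (sval (w m'))).
have h1 := seminorm_le hqL (p m').1 (p m).1.
have h2 := qdist_mem hq (wle _ _ mm' _ wm).
have h3 := qdist_le_self hq (hcl (sval (w m'))) ((p m).1 - (p m').1).
have h4 := seminorm_trans hq (p m).1 (p m).2 (p m').1.
have h5 := seminorm_trans hq (p m).2 x (p m').1.
have h6 := seminorm_trans hq x (p m').2 (p m').1.
have h7 := seminormC hq x (p m').2; have h8 := seminormC hq (p m').2 (p m').1.
have h9 := seminormC hqL (p m').1 (p m).1.
move: h1 h2 h3 h4 h5 h6 h7 h8 h9 qm' zm zm' hm hm'; lra.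
Qed.

End FiniteGeneration.

(** * Bounded semigroups on Banach spaces *)

Section ScalarField.
Variables (R : realType) (k : scalar_kind).
Local Notation F := (scalar_field R k).

Definition scalar_of_real : R -> F :=
  match k with RealScalars => id | ComplexScalars => real_complex R end.

Lemma scalar_of_realD a b : scalar_of_real (a + b) = scalar_of_real a + scalar_of_real b.
Proof. by rewrite /scalar_of_real; case: k => //; rewrite rmorphD. Qed.

Lemma scalar_of_realM a b : scalar_of_real (a * b) = scalar_of_real a * scalar_of_real b.
Proof. by rewrite /scalar_of_real; case: k => //; rewrite rmorphM. Qed.

Lemma scalar_of_real1 : scalar_of_real 1 = 1.
Proof. by rewrite /scalar_of_real; case: k. Qed.

Lemma scalar_of_real0 : scalar_of_real 0 = 0.
Proof. by rewrite /scalar_of_real; case: k. Qed.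

Lemma scalar_of_realK : cancel scalar_of_real (@scalar_re R k).
Proof. by rewrite /scalar_of_real /scalar_re; case: k. Qed.

Lemma scalar_reK (x : F) : 0 <= x -> scalar_of_real (scalar_re x) = x.
Proof.
rewrite /scalar_of_real /scalar_re; move: x; case: k => //= x x0.
by apply: RRe_real; exact: ger0_real.
Qed.

Lemma scalar_of_real_lt a b : (scalar_of_real a < scalar_of_real b) = (a < b).
Proof. by rewrite /scalar_of_real; case: k => //; rewrite ltcR. Qed.

Lemma scalar_of_real_le a b : (scalar_of_real a <= scalar_of_real b) = (a <= b).
Proof. by rewrite /scalar_of_real; case: k => //; rewrite lecR. Qed.

Lemma scalar_of_real_norm a : `|scalar_of_real a| = scalar_of_real `|a|.
Proof.
rewrite /scalar_of_real; case: k => //=; rewrite normc_def /= expr0n addr0.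
by rewrite sqrtr_sqr.
Qed.

End ScalarField.

Section RealNorm.
Variables (R : realType) (k : scalar_kind).
Local Notation F := (scalar_field R k).
Variable X : completeNormedModType F.
Implicit Types x y : X.

Lemma real_normE x : scalar_of_real k (real_norm x) = `|x|.
Proof. exact: scalar_reK. Qed.

Lemma real_norm_ge0 x : 0 <= real_norm x.
Proof.
by rewrite -(scalar_of_real_le k) real_normE scalar_of_real0.
Qed.

Lemma real_normD x y : real_norm (x + y) <= real_norm x + real_norm y.
Proof. by rewrite -(scalar_of_real_le k) scalar_of_realD !real_normE ler_normD. Qed.

Lemma real_normC x y : real_norm (x - y) = real_norm (y - x).
Proof. by rewrite /real_norm distrC. Qed.

Lemma real_normZ (a : F) x : real_norm (a *: x) = scalar_re `|a| * real_norm x.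
Proof.
by rewrite /real_norm normrZ -{1}[`|a|]scalar_reK// -{1}real_normE
  -scalar_of_realM scalar_of_realK.
Qed.

Lemma real_norm0_eq0 x : real_norm x = 0 -> x = 0.
Proof.
move=> x0; apply/eqP; rewrite -normr_eq0 -real_normE x0.
by rewrite scalar_of_real0.
Qed.

Lemma scalar_gt0_real (e : F) : 0 < e -> exists2 r, 0 < r & scalar_of_real k r = e.
Proof.
move=> e0; exists (scalar_re e); last by rewrite scalar_reK// ltW.
by rewrite -(scalar_of_real_lt k) scalar_reK ?ltW// scalar_of_real0.
Qed.

Lemma scalar_of_real_gt0 (r : R) : 0 < r -> 0 < scalar_of_real k r.
Proof. by rewrite -(scalar_of_real_lt k) scalar_of_real0. Qed.

Lemma nbhs_real_norm x (r : R) : 0 < r -> nbhs x [set y | real_norm (x - y) < r].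
Proof.
move=> r0; apply/nbhs_normP; exists (scalar_of_real k r).
  exact: scalar_of_real_gt0.
by move=> y /=; rewrite -real_normE scalar_of_real_lt.
Qed.

Lemma nbhs_real_normP x (A : set X) : nbhs x A ->
  exists2 r : R, 0 < r & forall y, real_norm (x - y) < r -> A y.
Proof.
move=> /nbhs_normP[e /= e0 h]; have [r r0 re] := scalar_gt0_real e0.
by exists r => // y xy; apply: h; rewrite /= -real_normE -re scalar_of_real_lt.
Qed.

Lemma cvg_real_norm (I : Type) (G : set_system I) (f : I -> X) x : Filter G ->
  (forall e : R, 0 < e -> G [set i | real_norm (f i - x) < e]) -> f @ G --> x.
Proof.
move=> FG h A /nbhs_real_normP[r r0 hr]; suff : G (f @^-1` A) by [].
apply: filterS (h r r0) => i /= fi.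
by apply: hr; rewrite real_normC.
Qed.

End RealNorm.

(* Restriction of scalars: real coefficients suffice for all the arguments below, and
   this treats the real and the complex case at once. *)
Definition realified (R : realType) (k : scalar_kind) (X : lmodType (scalar_field R k)) :
  Type := X.

Section Realification.
Variables (R : realType) (k : scalar_kind) (X : lmodType (scalar_field R k)).

HB.instance Definition _ := GRing.Zmodule.copy (realified X) X.

Definition realified_scale (r : R) (x : realified X) : realified X :=
  scalar_of_real k r *: (x : X).

Let realified_scaleA a b x :
  realified_scale a (realified_scale b x) = realified_scale (a * b) x.
Proof. by rewrite /realified_scale scalerA scalar_of_realM. Qed.

Let realified_scale1 : left_id 1 realified_scale.
Proof. by move=> x; rewrite /realified_scale scalar_of_real1 scale1r. Qed.

Let realified_scaleDr : right_distributive realified_scale +%R.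
Proof. by move=> a x y; rewrite /realified_scale scalerDr. Qed.

Let realified_scaleDl x : {morph realified_scale^~ x : a b / a + b}.
Proof. by move=> a b; rewrite /realified_scale scalar_of_realD scalerDl. Qed.

HB.instance Definition _ := GRing.Zmodule_isLmodule.Build R (realified X)
  realified_scaleA realified_scale1 realified_scaleDr realified_scaleDl.

Definition realified_map (f : {linear X -> X}) (x : realified X) : realified X := f x.

Let realified_map_linear f : linear (realified_map f).
Proof. by move=> a x y; rewrite /realified_map linearP. Qed.

HB.instance Definition _ f := GRing.isLinear.Build R (realified X) (realified X) _
  (realified_map f) (@realified_map_linear f).

Lemma realifiedZE (r : R) (x : realified X) : r *: x = scalar_of_real k r *: (x : X) :> X.
Proof. by []. Qed.

End Realification.

(** * The limsup seminorm of a bounded semigroup *)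

Section SemigroupSystem.
Variables (R : realType) (k : scalar_kind).
Local Notation F := (scalar_field R k).
Variables (X : completeNormedModType F) (T : R -> {linear X -> X}).
Hypotheses (hT : C0_semigroup T) (hbT : bounded_semigroup T).
Variables (K : set X) (hK : compact K).
Hypothesis hliminf : forall x : X, real_norm x <= 1 ->
  limf_einf (fun t => rho (T t x) K) +oo_R = 0%E.

Local Notation V := (realified X).

Lemma real_norm_seminorm : seminorm (@real_norm R k X : V -> R).
Proof.
split=> [x y|a x]; first exact: real_normD.
by rewrite realifiedZE real_normZ scalar_of_real_norm scalar_of_realK.
Qed.

Let hN := real_norm_seminorm.

Lemma semigroup_bound :
  exists2 M : R, 0 < M & forall t x, 0 <= t -> real_norm (T t x) <= M * real_norm x.
Proof.
have [M1 hM1] : exists M : R, forall t x, 0 <= t -> real_norm x <= 1 -> real_norm (T t x) <= M.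
  move: hbT; rewrite /bounded_semigroup; set S := ereal_sup _ => Slt.
  have leS t x : 0 <= t -> real_norm x <= 1 -> ((real_norm (T t x))%:E <= S)%E.
    move=> t0 x1; apply: (@le_trans _ _ (op_norm (T t))).
      by apply: ereal_sup_ubound; exists x.
    by apply: ereal_sup_ubound; exists t.
  move: Slt leS; case: S => [r|//|] _ leS; first by exists r.
  exists 0 => t x t0 x1; have := leS t x t0 x1; by rewrite leeNy_eq.
have M0 : 0 <= M1.
  rewrite (le_trans _ (hM1 0 0 _ _))//; first exact: real_norm_ge0.
  by rewrite (seminorm0 hN).
(* Adding 1 makes the bound positive, as needed for later divisions by [M]. *)
exists (M1 + 1) => [|t x t0]; first by rewrite ltr_wpDl.
have [x0|x0] := eqVneq (real_norm x) 0.
  by rewrite (real_norm0_eq0 x0) linear0 (seminorm0 hN) mulr0.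
have px : 0 < real_norm x by rewrite lt_neqAle eq_sym x0 real_norm_ge0.
have nZ (r : R) y : 0 < r -> real_norm (scalar_of_real k r *: y) = r * real_norm y.
  by move=> r0; rewrite real_normZ scalar_of_real_norm scalar_of_realK gtr0_norm.
have i0 : 0 < (real_norm x)^-1 by rewrite invr_gt0.
have := hM1 t (scalar_of_real k (real_norm x)^-1 *: x) t0.
rewrite nZ// mulVf// lexx linearZ nZ// => /(_ isT).
rewrite mulrC ler_pdivrMr// => /le_trans; apply.
by rewrite ler_pM2r// lerDl.
Qed.

(** The limit inferior is a supremum of infima over neighbourhoods of infinity, so the infimum over
    times beyond [max s 0] is at most 0. *)
Lemma semigroup_hit (x : X) (e s : R) : real_norm x <= 1 -> 0 < e ->
  exists t y, [/\ s <= t, 0 <= t, K y & real_norm (T t x - y) < e].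
Proof.
move=> x1 e0; pose A := [set t : R | Num.max s 0 <= t].
have FA : +oo_R A by apply: nbhs_pinfty_ge; exact: num_real.
have : (ereal_inf ((fun t => rho (T t x) K) @` A) < e%:E)%E.
  apply: (@le_lt_trans _ _ 0%E); last by rewrite lte_fin.
  rewrite -(hliminf x1) limf_einfE; apply: ereal_sup_ubound; by exists A.
move=> /ereal_inf_lt[_ [t At <-]] /ereal_inf_lt[_ [y Ky <-]].
rewrite lte_fin => h; exists t, y.
by move: At; rewrite /A /= ge_max => /andP[].
Qed.

Lemma compact_real_cluster (y : nat -> X) : (forall n, K (y n)) ->
  exists x, forall e : R, 0 < e -> forall n, exists2 m, (n <= m)%N & real_norm (y m - x) < e.
Proof.
move=> Ky; have [x [_ hx]] : K `&` cluster (y @ \oo) !=set0.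
  apply: hK; suff : \oo (y @^-1` K) by [].
  by apply: filterS (@filterT _ \oo _) => n _; exact: Ky.
exists x => e e0 n.
have An : (y @ \oo) [set y m | m in [set m | (n <= m)%N]].
  by exists n => // m /= nm; exists m.
have [_ [[m nm <-] h]] := hx _ _ An (nbhs_real_norm x e0).
by exists m => //; rewrite real_normC.
Qed.

(* The set is nonempty because the semigroup is bounded; otherwise the infimum would be
   the junk value [0]. *)
Definition semigroup_limsup (x : V) : R :=
  inf [set r | 0 <= r /\ exists2 s, 0 <= s & forall t, s <= t -> real_norm (T t x) <= r].

Local Notation q := semigroup_limsup.

Lemma semigroup_limsup_le (r s : R) (x : X) : 0 <= s ->
  (forall t, s <= t -> real_norm (T t x) <= r) -> q x <= r.
Proof.
move=> s0 h; apply: ge_inf; first by exists 0 => ? [].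
by split; [exact: le_trans (real_norm_ge0 _) (h _ (lexx s))|exists s].
Qed.

Lemma semigroup_limsup_lt (r : R) (x : X) : q x < r ->
  exists2 s, 0 <= s & forall t, s <= t -> real_norm (T t x) < r.
Proof.
have [M M0 hM] := semigroup_bound.
move=> h; have [|r' [r'0 [s s0 hs]] r'r] := inf_lt _ h.
  exists (M * real_norm x); split; first by rewrite mulr_ge0 ?real_norm_ge0 ?(ltW M0).
  by exists 0 => // t t0; exact: hM.
by exists s => // t /hs /le_lt_trans; apply.
Qed.

Lemma semigroup_limsup_seminorm : seminorm q.
Proof.
apply: seminorm_intro => [x y||a x].
- apply/ler_addgt0Pr => e e0; have e2 : 0 < e / 2 by rewrite divr_gt0.
  have [|s s0 hs] := @semigroup_limsup_lt (q x + e / 2) x; first by rewrite ltrDl.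
  have [|s' s'0 hs'] := @semigroup_limsup_lt (q y + e / 2) y; first by rewrite ltrDl.
  apply: (@semigroup_limsup_le _ (Num.max s s')); first by rewrite le_max s0.
  move=> t; rewrite ge_max => /andP[st s't]; rewrite linearD.
  rewrite (le_trans (real_normD _ _))// [e in leRHS]splitr addrACA lerD// ltW//.
    exact: hs.
  exact: hs'.
- apply/eqP; rewrite eq_le; apply/andP; split.
    by apply: (@semigroup_limsup_le _ 0) => // t _; rewrite linear0 (seminorm0 hN).
  by apply: lb_le_inf => [|r []//]; exists 0; split => //; exists 0 => // t _;
    rewrite linear0 (seminorm0 hN).
- have [->|a0] := eqVneq a 0.
    rewrite normr0 mul0r scale0r.
    by apply: (@semigroup_limsup_le _ 0) => // t _; rewrite linear0 (seminorm0 hN).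
  have a0' : 0 < `|a| by rewrite normr_gt0.
  apply/ler_addgt0Pr => e e0.
  have [|s s0 hs] := @semigroup_limsup_lt (q x + e / `|a|) x.
    by rewrite ltrDl divr_gt0.
  apply: (@semigroup_limsup_le _ s) => // t /hs h.
  rewrite -[T t _]/(realified_map (T t) (a *: x)) linearZ (seminormZ hN).
  rewrite -[e](divfK (lt0r_neq0 a0')) [_ / _ * _]mulrC -mulrDr ler_wpM2l//.
  exact: ltW.
Qed.

Lemma semigroup_limsup_bound : exists2 M : R, 0 < M & (forall t x, 0 <= t ->
  real_norm (T t x) <= M * real_norm x) /\ forall x : X, q x <= M * real_norm x.
Proof.
have [M M0 hM] := semigroup_bound; exists M => //; split => // x.
by apply: (@semigroup_limsup_le _ 0) => // t t0; exact: hM.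
Qed.

(** A limit superior at infinity ignores a shift of time. *)
Lemma semigroup_limsup_isometry t (x : X) : 0 <= t -> q (T t x) = q x.
Proof.
have [_ _ TD _] := hT.
move=> t0; apply/eqP; rewrite eq_le; apply/andP; split; apply/ler_addgt0Pr => e e0.
  have [|s s0 hs] := @semigroup_limsup_lt (q x + e) x; first by rewrite ltrDl.
  apply: (@semigroup_limsup_le _ s) => // r sr; rewrite -TD// ?(le_trans s0)//.
  by apply: ltW; apply: hs; rewrite (le_trans sr)// lerDl.
have [|s s0 hs] := @semigroup_limsup_lt (q (T t x) + e) (T t x); first by rewrite ltrDl.
apply: (@semigroup_limsup_le _ (s + t)); first by rewrite addr_ge0.
move=> r sr; have sr' : s <= r - t by rewrite lerBrDr.
rewrite -[r](subrK t) TD//; first exact/ltW/hs.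
exact: le_trans sr'.
Qed.

(** If [q x < 1], the orbit eventually enters the unit ball of the norm, and hitting is applied from
    that time [r] on. The bound [q <= M * real_norm] carries closeness, continuity and clustering
    over from the norm. *)
Lemma semigroup_hitting_system :
  hitting_system q (fun t => realified_map (T t)) K.
Proof.
have hq := semigroup_limsup_seminorm.
have [Tc T0 TD Tcont] := hT.
have [M M0 [hM hqM]] := semigroup_limsup_bound.
have qlt (x : X) (e : R) : real_norm x < e / M -> q x < e.
  by rewrite ltr_pdivlMr// mulrC; exact: le_lt_trans.
split => //.
- by move=> s t x s0 t0; exact: TD.
- by move=> t x t0; exact: semigroup_limsup_isometry.
- move=> x e e0; have eM : 0 < e / M by rewrite divr_gt0.
  have /nbhs_ballP[d /= d0 hd] := Tcont x _ (nbhs_real_norm x eM).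
  exists d => // t t0 td; apply: qlt.
  move: t0; rewrite le_eqVlt => /orP[/eqP <-|t0].
    by rewrite /realified_map T0 subrr (seminorm0 hN).
  rewrite real_normC; apply: hd => //.
  by rewrite /ball /= sub0r normrN gtr0_norm.
- move=> y Ky; have [x hx] := compact_real_cluster Ky; exists x => e e0 n.
  by have [m nm h] := hx _ (divr_gt0 e0 M0) n; exists m => //; exact: qlt.
- move=> x e s x1 e0; have [r r0 hr] := semigroup_limsup_lt x1.
  have [t [y [st t0 Ky h]]] := @semigroup_hit (T r x) (e / M) s (ltW (hr _ (lexx r)))
    (divr_gt0 e0 M0).
  exists (t + r), y; split => //; [|exact: addr_ge0|].
    by rewrite (le_trans st)// lerDl.
  by apply: qlt; rewrite /realified_map TD.
Qed.

End SemigroupSystem.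

Section SpanningFamilies.
Variables (F : fieldType) (V : lmodType F).

Lemma independent_spanning_family n (e : 'I_n -> V) : exists m (f : 'I_m -> V),
  (forall c : 'I_m -> F, \sum_i c i *: f i = 0 -> forall i, c i = 0) /\
  [set \sum_i c i *: e i | c in [set: 'I_n -> F]]
    = [set \sum_i c i *: f i | c in [set: 'I_m -> F]].
Proof.
elim: n e => [|n IH] e; first by exists 0%N, e; split => // c _ [].
have [ind|] := pselect (forall c : 'I_n.+1 -> F, \sum_i c i *: e i = 0 -> forall i, c i = 0).
  by exists n.+1, e.
move=> /existsNP[c /not_implyP[c0 /existsNP[j /eqP cj]]].
have [m [f [ind ef]]] := IH (fun i => e (lift j i)); exists m, f; split => //.
rewrite -ef; apply/seteqP; split => [_ [d _ <-]|_ [d _ <-]]; last first.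
  exists (fun i => if unlift j i is Some l then d l else 0) => //.
  rewrite (bigD1_ord j)//= unlift_none scale0r add0r.
  by apply: eq_bigr => i _; rewrite liftK.
(* Subtracting this multiple of the relation [c] cancels the coefficient at [j] without changing the
   sum. *)
pose d' i := d i - d j / c j * c i.
exists (fun i => d' (lift j i)) => //.
have d'j : d' j = 0 by rewrite /d' divfK// subrr.
transitivity (\sum_i d' i *: e i).
  by rewrite (bigD1_ord j)//= d'j scale0r add0r.
rewrite /d'; under eq_bigr do rewrite scalerBl -scalerA.
by rewrite sumrB -scaler_sumr c0 scaler0 subr0.
Qed.

End SpanningFamilies.

(** * Limits of orbits along an ultrafilter at infinity *)

Section Projection.
Variables (R : realType) (k : scalar_kind).
Local Notation F := (scalar_field R k).
Variables (X : completeNormedModType F) (T : R -> {linear X -> X}).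
Hypotheses (hT : C0_semigroup T) (hbT : bounded_semigroup T).
Variables (K : set X) (hK : compact K).
Hypothesis hliminf : forall x : X, real_norm x <= 1 ->
  limf_einf (fun t => rho (T t x) K) +oo_R = 0%E.

Local Notation V := (realified X).
Local Notation q := (semigroup_limsup T).

Let hN := @real_norm_seminorm R k X.
Let hs := semigroup_hitting_system hT hbT hK hliminf.
Let hq := semigroup_limsup_seminorm hbT.

Lemma realified_mapE t (x : V) : realified_map (T t) x = T t x.
Proof. by []. Qed.

Definition omega_limit_point (x y : X) := forall e s : R, 0 < e ->
  exists t, [/\ s <= t, 0 <= t & real_norm (T t x - y) < e].

Lemma omega_limit_point_exists x : exists y, omega_limit_point x y.
Proof.
wlog x1 : x / real_norm x <= 1.
  move=> H; pose r := real_norm x + 1.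
  have r0 : 0 < r by rewrite ltr_wpDl// real_norm_ge0.
  have [|y hy] := H ((r^-1 : R) *: (x : V)).
    rewrite (seminormZ hN) gtr0_norm ?invr_gt0// mulrC ler_pdivrMr// mul1r.
    by rewrite lerDl.
  exists (r *: (y : V)) => e s e0.
  have [t [st t0 h]] := hy (e / r) s (divr_gt0 e0 r0).
  exists t; split => //; move: h.
  rewrite -realified_mapE linearZ /= realified_mapE ltr_pdivlMr// mulrC.
  rewrite -{1}(gtr0_norm r0) -(seminormZ hN) scalerBr scalerA mulfV ?scale1r//.
  exact: lt0r_neq0.
have /choice[p hp] : forall n : nat, exists p : R * X,
    [/\ n%:R <= p.1, 0 <= p.1, K p.2 & real_norm (T p.1 x - p.2) < n.+1%:R^-1].
  move=> n; have n0 : 0 < n.+1%:R^-1 :> R by rewrite invr_gt0.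
  by have [t [y ?]] := semigroup_hit hliminf n%:R x1 n0; exists (t, y).
have Kp n : K (p n).2 by have [] := hp n.
have [y hy] := compact_real_cluster hK Kp.
exists y => e s e0; have e2 : 0 < e / 2 by rewrite divr_gt0.
have [N hN'] := inv_nat_small e2.
have [m] := hy _ e2 (maxn N (Num.truncn `|s|).+1).
rewrite geq_max => /andP[Nm sm] my; have [mp p0 _ h] := hp m.
exists (p m).1; split => //.
  rewrite (le_trans (ler_norm s))// (le_trans (ltW (truncnS_gt _)))//.
  by rewrite (le_trans _ mp)// ler_nat.
apply: (le_lt_trans (seminorm_trans hN _ (p m).2 _)).
by rewrite [ltRHS]splitr ltrD// (lt_trans h)// hN'.
Qed.

(** At a late time [t] with [T t x] near [y], the vector [T a y - T b y] is close to
    [T t (T a x - T b x)], whose norm hardly exceeds the limsup. This turns control by [q] into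
    control by the norm. *)
Lemma omega_limit_contraction x y a b : omega_limit_point x y -> 0 <= a -> 0 <= b ->
  real_norm (T a y - T b y) <= q (T a x - T b x).
Proof.
have [_ _ TD _] := hT; have [M M0 [hM _]] := semigroup_limsup_bound hbT.
move=> xy a0 b0; apply/ler_addgt0Pr => e e0.
have e2 : 0 < e / 2 by rewrite divr_gt0.
have [|s s0 hs'] := @semigroup_limsup_lt _ _ _ _ hbT
  (q (T a x - T b x) + e / 2) (T a x - T b x); first by rewrite ltrDl.
have [t [st t0 h]] := xy (e / 2 / (M + M)) s (divr_gt0 e2 (addr_gt0 M0 M0)).
have TC c : 0 <= c -> T t (T c x) = T c (T t x).
  by move=> c0; rewrite -!TD// addrC.
have := hs' t st; rewrite linearB /= !TC// => h1.
have ha := hM a (T t x - y) a0; have hb := hM b (T t x - y) b0.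
rewrite !linearB /= in ha hb.
have := seminorm_trans hN (T a y) (T a (T t x)) (T b y).
have := seminorm_trans hN (T a (T t x)) (T b (T t x)) (T b y).
have := seminormC hN (T a y) (T a (T t x)).
have h2 : M * real_norm (T t x - y) + M * real_norm (T t x - y) <= e / 2.
  by rewrite -mulrDl mulrC -ler_pdivlMr ?addr_gt0// ltW.
lra.
Qed.

(** Modulo the kernel of [q] the orbit lies in a finite span, hence is [q]-Cauchy along [W]. The
    contraction makes the orbit of an omega-limit point [y] norm-Cauchy, and [T t x] stays near
    [T (t - s) y] once [T s x] is near [y]. *)
Lemma orbit_ultralimit (W : set_system R) (UW : UltraFilter W) :
  (forall s, W [set t | s <= t]) -> forall x : X, exists y : X,
  forall e : R, 0 < e -> W [set t | real_norm (T t x - y) < e].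
Proof.
move=> Woo x; have [_ _ TD _] := hT; have [M M0 [hM hqM]] := semigroup_limsup_bound hbT.
have [E hE] := hs_finite_generation hs.
have /choice[z hz] : forall t : R, exists z : V, span_seq E z /\ q ((T t x : V) - z) = 0.
  by move=> t; have [z ? ?] := closure_span_seq hq (hE (T t x)); exists z.
have qz t : 0 <= t -> q (z t) <= q x.
  move=> t0; rewrite (le_trans (seminorm_le hq _ (T t x)))// (seminormC hq) (hz t).2 addr0.
  by rewrite (semigroup_limsup_isometry hT hbT).
have [y hy] := omega_limit_point_exists x.
suff : cauchy ((fun t => T t x) @ W).
  move=> /cauchy_cvg Wx; exists (lim ((fun t => T t x) @ W)) => e e0.
  have : W ((fun t => T t x) @^-1` [set y | real_norm (lim ((fun t => T t x) @ W) - y) < e]).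
    exact: Wx (nbhs_real_norm _ e0).
  by apply: filterS => t /=; rewrite real_normC.
apply: cauchy_exP => eps eps0; have [e e0 <-] := scalar_gt0_real eps0.
have e4 : 0 < e / 4 by rewrite divr_gt0.
have [s [_ s0 xs]] := hy (e / 4 / M) 0 (divr_gt0 e4 M0).
(* The absolute value keeps the time nonnegative at every index, so that the bound [q x] holds
   everywhere; on the set [s <= t] of [W] it disappears. *)
have [w _ hw] := @ultra_span_lim _ _ _ hq E _ W UW (fun t => z `|t - s|) (q x)
  (fun t => (hz _).1) (fun t => qz _ (normr_ge0 _)).
have WA : W ([set t | s <= t] `&` [set t | q (z `|t - s| - w) < e / 4]).
  exact: filterI (Woo s) (hw _ e4).
have [r [/= sr rw]] := filter_ex WA.
exists (T (r - s) y); suff : W [set t | real_norm (T (r - s) y - T t x) < e].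
  apply: filterS => t h.
  rewrite -ball_normE /ball_ /=.
  by rewrite -real_normE scalar_of_real_lt.
apply: filterS WA => t [/= st tw].
have rs0 : 0 <= r - s by rewrite subr_ge0.
have ts0 : 0 <= t - s by rewrite subr_ge0.
rewrite !ger0_norm// in rw tw.
have h1 := omega_limit_contraction hy rs0 ts0.
have h2 := hM (t - s) (y - T s x) ts0.
rewrite linearB /= -TD// subrK in h2.
have h3 : M * real_norm (y - T s x) <= e / 4.
  by rewrite mulrC -ler_pdivlMr// real_normC ltW.
have h4 := seminorm_trans hN (T (r - s) y) (T (t - s) y) (T t x).
have h5 := seminorm_trans hq (T (r - s) x) (z (r - s)) (T (t - s) x).
have h6 := seminorm_trans hq (z (r - s)) w (T (t - s) x).
have h7 := seminorm_trans hq w (z (t - s)) (T (t - s) x).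
have h8 := seminormC hq w (z (t - s)).
have h9 := seminormC hq (z (t - s)) (T (t - s) x).
have [_ z1] := hz (r - s); have [_ z2] := hz (t - s).
lra.
Qed.

Lemma semigroup_limsup_eq0_cvg (x : X) : q x = 0 -> T t x @[t --> +oo_R] --> (0 : X).
Proof.
move=> qx; apply: cvg_real_norm => e e0.
have [|s s0 h] := @semigroup_limsup_lt _ _ _ _ hbT e x; first by rewrite qx.
apply: (@filterS _ _ _ [set t | s <= t]) => [t st|]; last first.
  by apply: nbhs_pinfty_ge; exact: num_real.
by rewrite /= subr0; exact: h.
Qed.

Lemma semigroup_limsup_ker_closed : closed [set x : X | q x = 0].
Proof.
have [M M0 [_ hqM]] := semigroup_limsup_bound hbT.
move=> x hx; apply: (seminorm_small0 hq) => e e0.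
have [y [/= qy xy]] := hx _ (nbhs_real_norm x (divr_gt0 e0 M0)).
rewrite (le_trans (seminorm_le hq x y))// qy add0r (le_trans (hqM _))//.
by rewrite mulrC -ler_pdivlMr// ltW.
Qed.

Lemma rho_cvg0 (L : set X) (x l : X) : (forall t, 0 <= t -> L (T t l)) -> q (x - l) = 0 ->
  rho (T t x) L @[t --> +oo_R] --> 0%E.
Proof.
move=> hL qxl.
apply: (@squeeze_cvge _ +oo_R _ R (fun=> 0%E) (fun t => rho (T t x) L)
  (fun t => (real_norm (T t (x - l)))%:E)).
- apply: (@filterS _ _ _ [set t | 0 <= t]) => [t t0|]; last first.
    by apply: nbhs_pinfty_ge; exact: num_real.
  apply/andP; split.
    by apply: le_ereal_inf_tmp => _ [y _ <-]; rewrite lee_fin real_norm_ge0.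
  by apply: ereal_inf_lbound; exists (T t l); [exact: hL|rewrite linearB].
- exact: cvg_cst.
- apply: cvg_EFin; first by exact: nearW.
  apply/cvgrPdist_lt => e e0; have [s s0 h] := @semigroup_limsup_lt _ _ _ _ hbT e (x - l)
    (eq_ind_r (fun r => r < e) e0 qxl).
  apply: (@filterS _ _ _ [set t | s <= t]) => [t st|]; last first.
    by apply: nbhs_pinfty_ge; exact: num_real.
  by rewrite /= sub0r normrN ger0_norm ?real_norm_ge0// h.
Qed.

(** [P x] is the limit of [T t x] along an ultrafilter, and each property passes to the limit. [P]
    may fail to be idempotent (for a rotation group it is a rotation); only its range and kernel
    matter. *)
Lemma asymptotic_projection : exists P : X -> X,
  [/\ forall (a : F) x y, P (a *: x + y) = a *: P x + P y,
      forall t x, 0 <= t -> P (T t x) = T t (P x),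
      forall x, q (P x) = q x,
      forall x, q x = 0 -> P x = 0 &
      forall x (e : R), 0 < e -> exists2 t, 0 <= t & real_norm (T t x - P x) < e].
Proof.
have [W UW Woo] := ultra_pinfty R.
have /choice[P hP] := orbit_ultralimit UW Woo.
have [_ _ TD _] := hT; have [M M0 [hM hqM]] := semigroup_limsup_bound hbT.
have Peq x y : (forall e : R, 0 < e -> W [set t | real_norm (T t x - y) < e]) -> P x = y.
  move=> h; apply/eqP; rewrite -subr_eq0; apply/eqP/real_norm0_eq0.
  apply: (seminorm_small0 hN) => e e0; have e2 : 0 < e / 2 by rewrite divr_gt0.
  have [t [/= h1 h2]] := filter_ex (filterI (hP x _ e2) (h _ e2)).
  rewrite (le_trans (seminorm_trans hN _ (T t x) _))// [leRHS]splitr ltW// ltrD//.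
  by rewrite (seminormC hN).
have Pex x (e : R) : 0 < e -> exists2 t, 0 <= t & real_norm (T t x - P x) < e.
  by move=> e0; have [t [/= ? ?]] := filter_ex (filterI (Woo 0) (hP x _ e0)); exists t.
exists P; split => //.
- move=> a x y; apply: Peq => e e0; have e2 : 0 < e / 2 by rewrite divr_gt0.
  have a0 : 0 <= scalar_re `|a|.
    by rewrite -(scalar_of_real_le k) scalar_reK// scalar_of_real0.
  have a1 : 0 < scalar_re `|a| + 1 by rewrite ltr_wpDl.
  apply: filterS (filterI (hP x _ (divr_gt0 e2 a1)) (hP y _ e2)) => t [/= h1 h2].
  rewrite linearP opprD addrACA -scalerBr (le_lt_trans (real_normD _ _))//.
  rewrite [ltRHS]splitr ltrD// real_normZ; move: h1; rewrite ltr_pdivlMr//.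
  by apply: le_lt_trans; rewrite mulrC ler_wpM2l ?real_norm_ge0// lerDl.
- move=> s x s0; apply: Peq => e e0.
  apply: filterS (filterI (Woo 0) (hP x _ (divr_gt0 e0 M0))) => t [/= t0 h].
  have -> : T t (T s x) = T s (T t x) by rewrite -!TD// addrC.
  rewrite -linearB (le_lt_trans (hM _ _ s0))//.
  by rewrite mulrC -ltr_pdivlMr.
- move=> x; apply: (seminorm_limit hq) => e e0.
  have [t t0 h] := Pex x _ (divr_gt0 e0 M0); exists (T t x).
    by rewrite (semigroup_limsup_isometry hT hbT).
  by rewrite (le_lt_trans (hqM _))// mulrC -ltr_pdivlMr.
- move=> x qx; apply: Peq => e e0.
  have [|s s0 h] := @semigroup_limsup_lt _ _ _ _ hbT e x; first by rewrite qx.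
  by apply: filterS (Woo s) => t /h; rewrite /= subr0.
Qed.

End Projection.

Lemma span_seq_realified (R : realType) (k : scalar_kind)
    (X : completeNormedModType (scalar_field R k)) (E : seq (realified X)) (x : X) :
  span_seq E x ->
  exists c : 'I_(size E) -> scalar_field R k, \sum_i c i *: (E`_i : X) = x.
Proof.
elim: E x => [|e E IH] x /=; first by move=> ->; exists (fun=> 0); rewrite big_ord0.
move=> [a /IH[c hc]].
exists (fun i => if unlift ord0 i is Some j then c j else scalar_of_real k a).
rewrite big_ord_recl unlift_none /=; under eq_bigr do rewrite liftK.
by rewrite hc realifiedZE addrC subrK.
Qed.

Theorem theorem3 (R : realType) (k : scalar_kind)
    (X : completeNormedModType (scalar_field R k))
    (T : R -> {linear X -> X})
    (hT : C0_semigroup T) (hbT : bounded_semigroup T)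
    (K : set X) (hK : compact K)
    (hliminf : forall x : X, real_norm x <= 1 ->
       limf_einf (fun t => rho (T t x) K) +oo_R = 0%E) :
  exists L : set X,
    [/\ linear_subspace L, finite_dim L, invariant_under T L,
        forall x : X, rho (T t x) L @[t --> +oo_R] --> 0%E &
        exists X0 : set X,
          [/\ linear_subspace X0, closed X0, invariant_under T X0,
              direct_sum X0 L &
              forall x0 : X, X0 x0 -> T t x0 @[t --> +oo_R] --> (0 : X)]].
Proof.
pose hs := semigroup_hitting_system hT hbT hK hliminf.
have hq := hs_seminorm hs; set q := semigroup_limsup T in hs hq.
have [M M0 [hM hqM]] := semigroup_limsup_bound hbT.
have [_ _ TD _] := hT.
have [P [Plin PT qP P0 Papprox]] := asymptotic_projection hT hbT hK hliminf.
have [E hE] := hs_finite_generation hs.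
have P00 : P 0 = 0 by apply: P0; exact: seminorm0 hq.
have PD x y : P (x + y) = P x + P y by have := Plin 1 x y; rewrite !scale1r.
have PZ a x : P (a *: x) = a *: P x by rewrite -[a *: x]addr0 Plin P00 addr0.
have PB x y : P (x - y) = P x - P y by rewrite PD -scaleN1r PZ scaleN1r.
pose PE : seq (realified X) := map P E.
(* Modulo the kernel of [q], which [P] annihilates, [x] is a combination of [E]. *)
have spanP x : span_seq PE (P x).
  have [z Ez qz] := closure_span_seq hq (hE x).
  have -> : P x = P z by apply/eqP; rewrite -subr_eq0 -PB P0.
  have hPE := span_seq_subspace PE.
  apply: (@span_seq_min _ _ E [set z | span_seq PE (P z)]) Ez.
    split; first by rewrite /= P00; exact: subspace0 hPE.
    by move=> a u v Pu Pv; rewrite /= PD PZ; exact: (subspaceP hPE _ Pu Pv).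
  by move=> e eE; apply: span_seq_mem; exact: map_f.
pose L := range P.
have Lsub : subspace L.
  split; first by exists 0.
  by move=> a _ _ [x _ <-] [y _ <-]; exists (a *: x + y).
have Linv t x : 0 <= t -> L x -> L (T t x).
  by move=> t0 [y _ <-]; exists (T t y) => //; exact: PT.
(* By recurrence [x] is [q]-close to some [T r x] with [r >= t], and by isometry [T r x] is as
   [q]-close to [T (r - t) (P x)] as [T t x] is to [P x]. Thus [x] is in the [q]-closure of a finite
   span inside [L]. *)
have decomp x : exists2 l, L l & q (x - l) = 0.
  have hcl : closure_for q (span_seq PE) x.
    move=> e e0; have e2 : 0 < e / 2 by rewrite divr_gt0.
    have [t t0 ht] := Papprox x _ (divr_gt0 e2 M0).
    have [r [tr r0 hr]] := hs_recurrent hs x t e2.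
    have rt : 0 <= r - t by rewrite subr_ge0.
    exists (T (r - t) (P x)); first by rewrite -PT.
    apply: (le_lt_trans (seminorm_trans hq _ (T r x) _)); rewrite [ltRHS]splitr ltrD//.
      by rewrite (seminormC hq).
    rewrite -[r in T r x](subrK t) TD// -linearB.
    rewrite /q (semigroup_limsup_isometry hT hbT)// (le_lt_trans (hqM _))//.
    by rewrite mulrC -ltr_pdivlMr.
  have [w wE qw] := closure_span_seq hq hcl; exists w => //.
  apply: (@span_seq_min _ _ PE L) wE => [|_ /mapP[e _ ->]]; last by exists e.
  split; first exact: subspace0 Lsub.
  by move=> a u v Lu Lv; exact: (subspaceP Lsub).
have qinv t x : 0 <= t -> q x = 0 -> q (T t x) = 0.
  by move=> t0 qx; rewrite /q (semigroup_limsup_isometry hT hbT).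
have qsub : subspace ([set x | q x = 0] : set X).
  (* [q] is a seminorm for real scalars only; stability of its kernel under all scalars comes from
     identifying it with the kernel of [P]. *)
  have qP0 x : q x = 0 <-> P x = 0.
    by split=> [/P0//|Px]; rewrite /q -qP Px; exact: (seminorm0 hq).
  split; first exact: (seminorm0 hq).
  by move=> a x y /qP0 Px /qP0 Py; apply/qP0; rewrite Plin Px Py scaler0 addr0.
have subP (A : set X) : subspace A -> linear_subspace A.
  move=> hA; split; first exact: (mem_set (subspace0 hA)).
  by move=> a x y Ax Ay; exact: (mem_set (subspaceP hA a (set_mem Ax) (set_mem Ay))).
exists L; split.
- exact: subP.
- have [m [f [ind ef]]] := independent_spanning_family (fun i : 'I_(size PE) => PE`_i : X).
  exists m, f; split => //; rewrite -ef; apply/seteqP; split => [_ [x _ <-]|_ [c _ <-]].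
    by have [c hc] := span_seq_realified (spanP x); exists c.
  apply: big_ind => [|u v|i _]; first exact: (subspace0 Lsub).
    exact: (subspaceD Lsub).
  apply: (subspaceZ Lsub); have /mapP[e _ ->] := mem_nth 0 (ltn_ord i).
  by exists e.
- by move=> t t0 _ [x Lx <-]; exact: Linv.
- move=> x; have [l Ll qxl] := decomp x.
  by apply: (rho_cvg0 hbT _ qxl) => t t0; exact: Linv.
exists [set x | q x = 0]; split.
- exact: subP.
- exact (semigroup_limsup_ker_closed hbT).
- by move=> t t0 _ [x qx <-]; exact: qinv.
- split; apply/seteqP; split => // x.
  + by move=> _; have [l Ll qxl] := decomp x; exists (x - l) => //; exists l => //; rewrite subrK.
  (* For [x = P y] with [q x = 0], also [q y = q (P y) = 0], and then [P y = 0]. *)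
  + by move=> [/= qx [y _ Py]]; rewrite -Py P0// -qP Py.
  + by move=> ->; split; [exact: seminorm0 hq|exact: subspace0 Lsub].
- move=> x qx; exact: (semigroup_limsup_eq0_cvg hbT qx).
Qed.
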